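(* Let $n\in\mathbb N$ and $\lambda\in\mathbb T$. Then $\mathrm{Mult}(\mathcal H_{\lambda,n})=\mathcal H_{\lambda,n}\cap\mathrm{Mult}(\mathcal H_{\sigma,n-1})$.
   Context: $\mathbb D$ open unit disc, $\mathbb T$ unit circle, $dA$ normalized area measure on $\mathbb D$. For $\lambda\in\mathbb T$, $D_{\lambda,n}(f)=\frac{1}{n!(n-1)!}\int_{\mathbb D}|f^{(n)}(z)|^2\frac{1-|z|^2}{|z-\lambda|^2}(1-|z|^2)^{n-1}dA(z)$ and $\mathcal H_{\lambda,n}=\{f\in\mathcal O(\mathbb D):D_{\lambda,n}(f)<\infty\}$. For $f=\sum a_kz^k$ and $j\ge0$, $D_{\sigma,j}(f)=\sum_{k\ge j}\binom kj|a_k|^2$, $\mathcal H_{\sigma,j}=\{f:D_{\sigma,j}(f)<\infty\}$ (so $\mathcal H_{\sigma,0}$ is the Hardy space $H^2$). $\mathrm{Mult}(\mathcal H)=\{\varphi\in\mathcal O(\mathbb D):\varphi f\in\mathcal H\ \forall f\in\mathcal H\}$. *)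

(* Defs.v *)
From HB Require Import structures.
From mathcomp Require Import all_boot all_order all_algebra.
From mathcomp Require Import all_classical all_reals all_analysis.
From mathcomp Require Import complex.
Set Implicit Arguments. Unset Strict Implicit. Unset Printing Implicit Defensive.
Import Order.TTheory GRing.Theory Num.Theory.
Import numFieldNormedType.Exports.
Local Open Scope classical_set_scope.
Local Open Scope ring_scope.
Local Open Scope complex_scope.

Section Defs.
Variable R : realType.

Definition csq (z : R[i]) : R := complex.Re z ^+ 2 + complex.Im z ^+ 2.

(* A holomorphic function on D is encoded by its Taylor coefficients at 0:
   f = \sum_k a k z^k, with the series absolutely convergent on D
   (i.e. radius of convergence >= 1). *)
Definition holo (a : nat -> R[i]) : Prop :=
  forall r : R, 0 <= r -> r < 1 ->
    cvgn (series (fun k => Num.sqrt (csq (a k)) * r ^+ k)).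

Definition peval (a : nat -> R[i]) (z : R[i]) : R[i] :=
  (limn (series (fun k => complex.Re (a k * z ^+ k))))
  +i* (limn (series (fun k => complex.Im (a k * z ^+ k)))).

Definition dcoef (n : nat) (a : nat -> R[i]) (k : nat) : R[i] :=
  ((k + n) ^_ n)%:R * a (k + n)%N.

Definition pderiv (n : nat) (a : nat -> R[i]) (z : R[i]) : R[i] :=
  peval (dcoef n a) z.

Definition pmul (a b : nat -> R[i]) (k : nat) : R[i] :=
  \sum_(i < k.+1) a i * b (k - i)%N.

Definition disc : set (R * R) := [set p | p.1 ^+ 2 + p.2 ^+ 2 < 1].

Definition Dlam_integrand (n : nat) (lam : R[i]) (a : nat -> R[i]) (p : R * R) : R :=
  let z := p.1 +i* p.2 in
  csq (pderiv n a z) * ((1 - csq z) / csq (z - lam)) * (1 - csq z) ^+ (n.-1).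

(* D_{lambda,n}(f); dA = (1/pi) dx dy is normalized area measure *)
Definition Dlam (n : nat) (lam : R[i]) (a : nat -> R[i]) : \bar R :=
  ((((n`! * (n.-1)`!)%:R)^-1 * pi^-1)%:E *
   \int[(@lebesgue_measure R \x @lebesgue_measure R)%E]_(p in disc)
      (Dlam_integrand n lam a p)%:E)%E.

Definition Hlam (n : nat) (lam : R[i]) : set (nat -> R[i]) :=
  [set a | holo a /\ (Dlam n lam a < +oo)%E].

Definition Dsig (j : nat) (a : nat -> R[i]) : \bar R :=
  (\sum_(j <= k <oo) (('C(k, j))%:R * csq (a k))%:E)%E.

Definition Hsig (j : nat) : set (nat -> R[i]) :=
  [set a | holo a /\ (Dsig j a < +oo)%E].

Definition Mult (H : set (nat -> R[i])) : set (nat -> R[i]) :=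
  [set phi | holo phi /\ forall f, H f -> H (pmul phi f)].

End Defs.

(* Main.v *)
Require Import Defs.
From HB Require Import structures.
From mathcomp Require Import all_boot all_order all_algebra.
From mathcomp Require Import all_classical all_reals all_analysis.
From mathcomp Require Import complex.
From mathcomp Require Import measurable_realfun beta_distribution ring lra zify.
Set Implicit Arguments. Unset Strict Implicit. Unset Printing Implicit Defensive.
Import Order.TTheory GRing.Theory Num.Theory.
Import numFieldNormedType.Exports.
Local Open Scope classical_set_scope.
Local Open Scope ring_scope.

   
                                                                         
                                                                               
                                                                   
                                
                                                                            
                                                                                      
                                                              
                                                                                          
                                                                                                
                                                                                                                    
                                                     
                                                                                   
                                                                                             

                                                                                           
                                                                                                 
                                                                                                
                           
  

(** Write [n = m.+1]. Everything rests on a local Douglas description ([HlamP]): f lies in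
    H_{lam,m+1} exactly when f is holomorphic and f = c + (z - lam) g with c constant and g in
    H_{sigma,m}.

    Granted this, let phi = c' + (z - lam) g and f = c + (z - lam) h. Then phi f = const + (z -
    lam)(c g + phi h), so phi multiplies H_{lam,m+1} as soon as it multiplies H_{sigma,m}.
    Conversely, a multiplier phi of H_{lam,m+1} lies in that space because 1 does. For h in
    H_{sigma,m}, the function (z - lam) phi h lies in H_{lam,m+1}, hence equals const + (z - lam) k
    with k in H_{sigma,m}. So phi h - k has coefficients proportional to lam^{-j}. Inserting phi =
    c' + (z - lam) g shows that its lam-twisted partial sums grow sublinearly, which forces phi h =
    k ([geometric_defect_zero]).

    For the Douglas description, write f^{(m+1)} = (z - lam) G. Up to a positive constant,
    D_{lam,m+1}(f) is the integral of |G|^2 (1 - |z|^2)^{m+1}, and by Parseval ([wint_finite]) its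
    finiteness is that of the sum of |G_k|^2 k! (m+1)! / (k+m+2)!. Let A_k be the mean of m! lam^j
    g_{j+m} over j <= k with weights C(j+m,m), whose total is W_k = C(k+m+1,m+1). The terms of that
    sum equal (k+m+2) W_k |A_{k+1} - A_k|^2 ([quotient_energy]), and [energy_identity] compares
    their partial sums with those of D_{sigma,m}(g), the remainder being (m+1) W_K |A_K|^2. Hence g
    in H_{sigma,m} bounds the energy. In the other direction, finite energy makes A_k tend to some L
    with W_k |A_k - L|^2 bounded ([jump_limit]). Subtracting a multiple of lam^{-k} from g changes f
    only by a constant and moves L to 0 ([rep_shift]), so the remainder stays bounded.

    Orthogonality of monomials comes from rotation invariance of area, the parallelogram law and
    dyadic roots of unity; the radial moments are Beta integrals. *)

Section planar.
Variable R : realType.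
Notation leb := (@lebesgue_measure R).
Notation leb2 := ((@lebesgue_measure R \x @lebesgue_measure R)%E).
Notation R1 := (measurableTypeR R).
Notation R2 := (measurableTypeR R * measurableTypeR R)%type.

(** * Planar Lebesgue measure under shears, rotations and dilations *)

Definition affine (a b : R) (x : R1) : R1 := a * (x : R) + b.

Lemma measurable_fun_affine (a b : R) :
  measurable_fun [set: R1] (affine a b).
Proof.
apply: measurable_funD => //; apply: measurable_funM => //.
Qed.

Lemma lebesgue_translation (s : R) (A : set R1) : measurable A ->
  leb ((affine 1 s) @^-1` A) = leb A.
Proof.
have mf := @measurable_fun_affine 1 s.
move=> mA; apply/esym.
pose nu : {measure set R1 -> \bar R} := pushforward leb (affine 1 s).
suff H : forall X, ocitv X -> leb X = nu mf X by exact: (lebesgue_measure_unique H mA).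
move=> _ [[a b] _ <-].
rewrite /nu /pushforward /=.
rewrite [X in _ = lebesgue_measure X](_ : _ = [set` `]a - s, b - s]]); last first.
  by apply/seteqP; split => x /=; rewrite /affine !in_itv /= mul1r ltrBlDr lerBrDr.
rewrite !lebesgue_measure_itv /= !lte_fin ltrD2r.
by case: ifP => // _; rewrite -!EFinB; congr EFin; ring.
Qed.

Lemma lebesgue_scaling (s : R) (A : set R1) : 0 < s -> measurable A ->
  (s%:E * leb ((affine s 0) @^-1` A) = leb A)%E.
Proof.
have mf := @measurable_fun_affine s 0.
move=> s0 mA; apply/esym.
pose nu : {measure set R1 -> \bar R} :=
  mscale (NngNum (ltW s0)) (pushforward leb (affine s 0)).
transitivity (nu mf A) => //.
suff H : forall X, ocitv X -> leb X = nu mf X by exact: (lebesgue_measure_unique H mA).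
move=> _ [[a b] _ <-].
rewrite /nu /mscale /pushforward /=.
rewrite [X in _ = (_ * lebesgue_measure X)%E](_ : _ = [set` `]a / s, b / s]]); last first.
  by apply/seteqP; split => x /=; rewrite /affine !in_itv /= addr0 ltr_pdivrMr// ler_pdivlMr// mulrC.
rewrite !lebesgue_measure_itv /= !lte_fin ltr_pM2r ?invr_gt0//.
case: ifP => // _; rewrite ?mule0// -!EFinB -EFinM; congr EFin.
by field; rewrite gt_eqF.
Qed.

Lemma measurable_fun_linear (a b : R) :
  measurable_fun [set: R2] (fun p : R2 => a * (p.1 : R) + b * (p.2 : R) : R1).
Proof.
by apply: measurable_funD => //; apply: measurable_funM.
Qed.

Definition lin2 (a b c d : R) (p : R2) : R2 :=
  (a * (p.1 : R) + b * (p.2 : R), c * (p.1 : R) + d * (p.2 : R)).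

Lemma measurable_lin2 a b c d : measurable_fun [set: R2] (lin2 a b c d).
Proof. by apply: measurable_fun_pair; exact: measurable_fun_linear. Qed.

Lemma measurable_lin2_preimage a b c d A : measurable A -> measurable (lin2 a b c d @^-1` A).
Proof. by move=> mA; rewrite -[X in measurable X]setTI; exact: measurable_lin2. Qed.

Lemma shear2_measure (s : R) (A : set R2) : measurable A ->
  leb2 (lin2 1 0 s 1 @^-1` A) = leb2 A.
Proof.
move=> mA; rewrite /product_measure1; apply: eq_integral => x _ /=.
rewrite -(@lebesgue_translation (s * x) (xsection A x)); last exact: measurable_xsection.
congr (lebesgue_measure _); apply/seteqP; split => y /=; rewrite /xsection /= !inE /affine /lin2 /=;
 by rewrite mul0r addr0 !mul1r addrC.
Qed.

Lemma swap2_measure (A : set R2) : measurable A -> leb2 (lin2 0 1 1 0 @^-1` A) = leb2 A.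
Proof.
move=> mA; have mf := measurable_lin2 0 1 1 0.
pose nu : {measure set R2 -> \bar R} := pushforward leb2 (lin2 0 1 1 0).
apply/esym; apply: (@product_measure_unique _ _ _ _ _ leb leb (nu mf)) => // X Y mX mY.
rewrite /nu /pushforward /=.
transitivity (leb2 (Y `*` X)); last by rewrite product_measure1E// muleC.
by apply: (congr1 leb2); apply/seteqP; split => -[x y] /=; rewrite /lin2 /= !mul0r !mul1r addr0 add0r => -[].
Qed.

Lemma shear1_measure (s : R) (A : set R2) : measurable A ->
  leb2 (lin2 1 s 0 1 @^-1` A) = leb2 A.
Proof.
move=> mA; have sw := measurable_lin2_preimage 0 1 1 0 mA.
refine (etrans _ (swap2_measure mA)); refine (etrans _ (shear2_measure s sw)).
refine (etrans _ (swap2_measure (measurable_lin2_preimage _ _ _ _ sw))).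
apply: (congr1 leb2); apply/seteqP; split => -[x y] /=; rewrite /lin2 /=;
 by rewrite !(mul0r, mul1r, addr0, add0r) (addrC x).
Qed.

                                                
(** A rotation is a product of three shears, each of which preserves area. For a = cos x and b = sin
    x, the outer shears have parameter t = (a - 1) / b = - tan(x/2), whence the condition
    [b != 0]. *)
Lemma rotation_measure (a b : R) (A : set R2) : b != 0 -> a ^+ 2 + b ^+ 2 = 1 ->
  measurable A -> leb2 (lin2 a (- b) b a @^-1` A) = leb2 A.
Proof.
move=> b0 ab1 mA; pose t := (a - 1) / b.
have tb : t * b = a - 1 by rewrite /t mulfVK.
have E : b * t * t + 2 * t = - b.
  apply: (mulIf b0); rewrite (_ : _ * b = (t * b) * (t * b) + 2 * (t * b)); last by ring.
  have -> : - b * b = a ^+ 2 - (a ^+ 2 + b ^+ 2) by ring.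
  by rewrite tb ab1; ring.
have F p : lin2 1 t 0 1 (lin2 1 0 b 1 (lin2 1 t 0 1 p)) = lin2 a (- b) b a p.
  case: p => x y; rewrite /lin2 /= -E (_ : a = 1 + t * b); last by rewrite tb; ring.
  by congr (_, _); ring.
have m1 := measurable_lin2_preimage 1 t 0 1 mA.
have m2 := measurable_lin2_preimage 1 0 b 1 m1.
refine (etrans _ (shear1_measure t mA)); refine (etrans _ (shear2_measure b m1)).
refine (etrans _ (shear1_measure t m2)); apply: (congr1 leb2).
by apply/seteqP; split => p /=; rewrite F.
Qed.

Lemma scaling2_measure (s : R) (A : set R2) : 0 < s -> measurable A ->
  ((s ^+ 2)%:E * leb2 (lin2 s 0 0 s @^-1` A) = leb2 A)%E.
Proof.
move=> s0 mA; have mf := measurable_lin2 s 0 0 s.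
have s20 : 0 <= s ^+ 2 by rewrite exprn_ge0// ltW.
pose nu : {measure set R2 -> \bar R} := mscale (NngNum s20) (pushforward leb2 (lin2 s 0 0 s)).
transitivity (nu mf A) => //.
apply/esym; apply: (@product_measure_unique _ _ _ _ _ leb leb (nu mf)) => // X Y mX mY.
rewrite /nu /mscale /pushforward /=.
rewrite -(lebesgue_scaling s0 mX) -(lebesgue_scaling s0 mY).
have mp (B : set R1) : measurable B -> measurable ((affine s 0) @^-1` B).
  by move=> mB; rewrite -[X in measurable X]setTI; exact: measurable_fun_affine.
rewrite -(muleACA) -EFinM -expr2; congr (_ * _)%E.
refine (etrans _ (product_measure1E _ _ (mp _ mX) (mp _ mY))).
apply: (congr1 leb2); apply/seteqP; split => -[x y] /=; rewrite /affine /lin2 /=;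
 by rewrite !mul0r !addr0 !add0r.
Qed.
End planar.

(** * Integration on the disc: rotation invariance and radial moments *)

Section disc_integral.
Variable R : realType.
Notation leb := (@lebesgue_measure R).
Notation leb2 := ((@lebesgue_measure R \x @lebesgue_measure R)%E).
Notation R1 := (measurableTypeR R).
Notation R2 := (measurableTypeR R * measurableTypeR R)%type.

Definition sqmod (p : R2) : R1 := (p.1 : R) ^+ 2 + (p.2 : R) ^+ 2.

Lemma measurable_sqmod : measurable_fun [set: R2] sqmod.
Proof. by apply: measurable_funD; apply: measurable_funX. Qed.

Lemma measurable_sqmod_preimage A : measurable A -> measurable (sqmod @^-1` A).
Proof. by move=> mA; rewrite -[X in measurable X]setTI; exact: measurable_sqmod. Qed.

Lemma sqmod_lt_disc : sqmod @^-1` `]-oo, 1[ = @disc R.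
Proof. by apply/seteqP; split => p /=; rewrite in_itv. Qed.

Lemma measurable_disc : measurable (@disc R : set R2).
Proof. by rewrite -sqmod_lt_disc; exact: measurable_sqmod_preimage. Qed.

Definition zof (p : R * R) : R[i] := Complex p.1 p.2.

Lemma zof_rotation (a b : R) (p : R2) : zof (lin2 a (- b) b a p) = Complex a b * zof p.
Proof.
by case: p => x y; rewrite /zof /lin2 /=; apply/eqP; rewrite eq_complex /= mulNr !eqxx addrC eqxx.
Qed.

Lemma csq_zof p : csq (zof p) = sqmod p.
Proof. by []. Qed.

Lemma csqM (x y : R[i]) : csq (x * y) = csq x * csq y.
Proof. by case: x => a b; case: y => c d; rewrite /csq /=; ring. Qed.

Lemma disc_integral_rotation (a b : R) (F : R2 -> \bar R) : b != 0 -> a ^+ 2 + b ^+ 2 = 1 ->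
  measurable_fun (@disc R) F -> (forall p, @disc R p -> 0 <= F p)%E ->
  (\int[leb2]_(p in @disc R) F (lin2 a (- b) b a p) = \int[leb2]_(p in @disc R) F p)%E.
Proof.
move=> b0 ab1 mF F0; have mf := measurable_lin2 a (- b) b a.
pose nu : {measure set R2 -> \bar R} := pushforward leb2 (lin2 a (- b) b a).
transitivity (\int[nu mf]_(p in @disc R) F p)%E; last first.
  apply: eq_measure_integral => A mA _; exact: rotation_measure.
rewrite /nu ge0_integral_pushforward//; last 2 first.
- exact: measurable_disc.
- by move=> p; rewrite inE; exact: F0.
congr integral; apply/seteqP; split=> p; rewrite /disc /=.
all: have := csqM (Complex a b) (zof p); rewrite -zof_rotation /csq /= ab1 mul1r => ->; done.
Qed.

Lemma sqmod_measure (b : R) : 0 < b ->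
  (leb2 (sqmod @^-1` `]-oo, b[) = b%:E * leb2 (@disc R))%E.
Proof.
move=> b0; pose s := Num.sqrt b; have s0 : 0 < s by rewrite sqrtr_gt0.
have m1 : measurable (sqmod @^-1` `]-oo, b[) by exact: measurable_sqmod_preimage.
refine (etrans (esym (scaling2_measure s0 m1)) _).
rewrite (sqr_sqrtr (ltW b0)); apply: (congr1 (mule b%:E)).
apply: (congr1 leb2); apply/seteqP; split => p; rewrite /disc /lin2 /sqmod /= !in_itv /=;
  rewrite !mul0r addr0 add0r !exprMn -mulrDr sqr_sqrtr ?ltW// => h.
- by rewrite -(ltr_pM2l b0) mulr1.
- by rewrite -[ltRHS]mulr1 ltr_pM2l.
Qed.

Lemma disc_measure_finite : (leb2 (@disc R) < +oo)%E.
Proof.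
pose S := [set` `]-1, (1:R)]] : set R1.
have mS : measurable S by exact: measurable_itv.
apply: (@le_lt_trans _ _ (leb2 (S `*` S))%E).
  apply: le_measure; rewrite ?inE; [exact: measurable_disc|exact: measurableX|].
  move=> [x y]; rewrite /disc /S /= !in_itv /= => h.
  have hx : x ^+ 2 < 1 by apply: le_lt_trans h; rewrite lerDl sqr_ge0.
  have hy : y ^+ 2 < 1 by apply: le_lt_trans h; rewrite lerDr sqr_ge0.
  by split; apply/andP; split; nra.
rewrite product_measure1E// /S /= lebesgue_measure_itv /= lte_fin.
by case: ifP => _; rewrite -?EFinB -?EFinM ?mule0 ltry.
Qed.

Lemma disc_measure_gt0 : (0 < leb2 (@disc R))%E.
Proof.
pose S := [set` `]0, (2^-1:R)]] : set R1.
have mS : measurable S by exact: measurable_itv.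
apply: (@lt_le_trans _ _ (leb2 (S `*` S))%E); last first.
  apply: le_measure; rewrite ?inE; [exact: measurableX|exact: measurable_disc|].
  move=> [x y]; rewrite /disc /S /= !in_itv /= => -[/andP[h1 h2] /andP[h3 h4]].
  have : 2^-1 = (1 / 2 :> R) by rewrite mul1r.
  by move=> e; rewrite e in h2 h4; nra.
rewrite product_measure1E// /S /= lebesgue_measure_itv /= lte_fin invr_gt0 ltr0n /=.
by rewrite -EFinB -EFinM lte_fin subr0 mulr_gt0 // invr_gt0.
Qed.

(** Kept as an unevaluated positive constant: it multiplies every moment alike and so does not
    affect finiteness. *)
Definition area : R := fine (leb2 (@disc R)).
Lemma area_gt0 : 0 < area.
Proof. by apply: fine_gt0; rewrite disc_measure_gt0 disc_measure_finite. Qed.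

Lemma areaE : leb2 (@disc R) = area%:E.
Proof. by rewrite /area fineK// ge0_fin_numE ?disc_measure_finite// ltW// disc_measure_gt0. Qed.

(** The disc of squared radius x has area proportional to x, so the law of |z|^2 is a multiple of
    Lebesgue measure on the half-line. The two measures are compared on the rays []-oo, x[], a
    generating family stable under intersection. *)
Lemma sqmod_pushforward (A : set R1) : measurable A -> A `<=` `[0, +oo[ ->
  leb2 (sqmod @^-1` A) = (area%:E * leb A)%E.
Proof.
move=> mA A0; have mf := measurable_sqmod.
have mI : measurable (`[(0:R), +oo[ : set R1) by [].
pose nu : {measure set R1 -> \bar R} := pushforward leb2 sqmod.
pose mu := mscale (NngNum (ltW area_gt0)) (mrestr leb mI).
have muE B : mu B = (area%:E * leb (B `&` `[0%R, +oo[))%E by [].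
have nuE B : nu mf B = leb2 (sqmod @^-1` B) by [].
suff H : nu mf A = mu A.
  by rewrite -nuE H muE setIidl.
pose G : set (set R1) := [set A | exists x, A = `]-oo, x[%classic].
have e x : nu mf `]-oo, x[%classic = mu `]-oo, x[%classic.
  rewrite muE nuE.
  have [x0|x0] := ltP 0 x.
    rewrite (_ : _ `&` _ = [set` `[0, x[]); last first.
      by apply/seteqP; split => y /=; rewrite !in_itv /= ?andbT; [move=> [-> ->]|move=> /andP[-> ->]].
    rewrite lebesgue_measure_itv /= lte_fin x0 sube0 muleC -areaE.
    exact: sqmod_measure.
  rewrite (_ : _ `&` _ = set0); last first.
    apply/seteqP; split => y //=; rewrite !in_itv /= andbT => -[h1 h2].
    by have := lt_le_trans (le_lt_trans h2 h1) x0; rewrite ltxx.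
  rewrite measure0 mule0 (_ : _ @^-1` _ = set0) ?measure0//.
  apply/seteqP; split => y //=; rewrite in_itv /= => h.
  have : sqmod y < 0 by apply: lt_le_trans h x0.
  by rewrite ltNge addr_ge0 ?sqr_ge0.
apply: (@measure_unique _ _ _ G (fun k => `]-oo, k%:R[%classic)) => //.
- exact: RGenInftyO.measurableE.
- move=> _ _ [x ->] [y ->]; exists (Order.min x y).
  by apply/seteqP; split => z /=; rewrite !in_itv /= lt_min; [move=> [-> ->]|move=> /andP[]].
- by move=> i; exists i%:R.
- apply/seteqP; split => // x _; exists (Num.trunc `|x|).+1 => //=.
  rewrite in_itv /=; apply: le_lt_trans (ler_norm x) _.
  exact: truncnS_gt.
- by move=> B [x ->]; exact: e.
- move=> k; rewrite e muE.
  apply: lte_mul_pinfty => //=; first by rewrite lee_fin ltW// area_gt0.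
  apply: (@le_lt_trans _ _ (leb `[0%R, (k%:R : R)[%classic)).
    apply: le_measure; rewrite ?inE; [exact: measurableI|exact: measurable_itv|].
    by move=> y /=; rewrite !in_itv /= andbT => -[-> ->].
  by rewrite /= lebesgue_measure_itv /=; case: ifP => _; rewrite ?ltry.
Qed.

(** The substitution t = |z|^2 turns this into the Beta integral of t^k (1 - t)^n over [0, 1]. *)
Lemma radial_moment (k n : nat) :
  (\int[leb2]_(p in @disc R) (sqmod p ^+ k * (1 - sqmod p) ^+ n)%:E =
   (area * ((k`! * n`!)%:R / (k + n).+1`!%:R))%:E)%E.
Proof.
have mf := measurable_sqmod.
have dE : @disc R = sqmod @^-1` `[0, 1[.
  by apply/seteqP; split => p /=; rewrite in_itv /= ?addr_ge0 ?sqr_ge0.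
pose nu : {measure set R1 -> \bar R} := pushforward leb2 sqmod.
have mX : measurable_fun [set: R1] (fun t : R1 => (XMonemX k n (t : R))%:E).
  by apply/measurable_EFinP; exact: measurable_XMonemX.
transitivity (\int[nu mf]_(t in `[0%R, 1%R[) (XMonemX k n (t : R))%:E)%E.
  rewrite /nu ge0_integral_pushforward//; first by rewrite dE.
  - exact: measurable_funTS.
  - move=> t; rewrite inE /= in_itv /= => /andP[t0 /ltW t1].
    by rewrite lee_fin XMonemX_ge0// in_itv /= t0 t1.
pose mu := mscale (NngNum (ltW area_gt0)) leb.
transitivity (\int[mu]_(t in `[0%R, 1%R[) (XMonemX k n (t : R))%:E)%E.
  apply: eq_measure_integral => A mA A1; apply: sqmod_pushforward => //.
  by move=> x /A1 /=; rewrite !in_itv /= => /andP[->].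
rewrite ge0_integral_mscale//; last 2 first.
- exact: measurable_funTS.
- move=> t; rewrite /= in_itv /= => /andP[t0 /ltW t1].
  by rewrite lee_fin XMonemX_ge0// in_itv /= t0 t1.
rewrite integral_itv_bndo_bndc; last exact: measurable_funTS.
by rewrite -beta_fun_fact EFinM EFin_beta_fun /= integral_XMonemX_restrict setTI.
Qed.
End disc_integral.

(** * Complex modulus and growth criteria for holomorphic coefficient sequences *)

Section power_series.
Variable R : realType.
Implicit Types (a b : nat -> R[i]) (z w : R[i]).

Definition cabs z : R := Num.sqrt (csq z).

Lemma csq_ge0 z : 0 <= csq z.
Proof. by rewrite addr_ge0 ?sqr_ge0. Qed.

Lemma cabs_ge0 z : 0 <= cabs z.
Proof. exact: sqrtr_ge0. Qed.

Lemma sqr_cabs z : cabs z ^+ 2 = csq z.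
Proof. by rewrite sqr_sqrtr// csq_ge0. Qed.

Lemma cabsE z : cabs z = ComplexField.Normc.normc z.
Proof. by case: z. Qed.

Lemma cabsM z w : cabs (z * w) = cabs z * cabs w.
Proof. by rewrite !cabsE ComplexField.Normc.normcM. Qed.

Lemma cabsD z w : cabs (z + w) <= cabs z + cabs w.
Proof. by rewrite !cabsE le_normcD. Qed.

Lemma cabsN z : cabs (- z) = cabs z.
Proof. by rewrite !cabsE normcN. Qed.

Lemma cabs0 : cabs 0 = 0.
Proof. by rewrite cabsE ComplexField.Normc.normc0. Qed.

Lemma cabs1 : cabs 1 = 1.
Proof. by rewrite cabsE ComplexField.Normc.normc1. Qed.

Lemma cabsX z n : cabs (z ^+ n) = cabs z ^+ n.
Proof. by elim: n => [|n IH]; rewrite ?expr0 ?cabs1// !exprS cabsM IH. Qed.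

Lemma cabs_nat n : cabs n%:R = n%:R.
Proof. by rewrite cabsE -[n%:R]/(1 *+ n) normcMn ComplexField.Normc.normc1. Qed.

Lemma cabs_sum (I : Type) (r : seq I) (P : pred I) (F : I -> R[i]) :
  cabs (\sum_(i <- r | P i) F i) <= \sum_(i <- r | P i) cabs (F i).
Proof.
elim/big_ind2: _ => //; first by rewrite cabs0.
by move=> x x' y y' h h'; apply: le_trans (cabsD _ _) _; exact: lerD.
Qed.

Lemma Re_le_cabs z : `|complex.Re z| <= cabs z.
Proof. by rewrite -sqrtr_sqr ler_wsqrtr// lerDl sqr_ge0. Qed.

Lemma Im_le_cabs z : `|complex.Im z| <= cabs z.
Proof. by rewrite -sqrtr_sqr ler_wsqrtr// lerDr sqr_ge0. Qed.

Lemma cReD z w : complex.Re (z + w) = complex.Re z + complex.Re w.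
Proof. by case: z; case: w. Qed.

Lemma cImD z w : complex.Im (z + w) = complex.Im z + complex.Im w.
Proof. by case: z; case: w. Qed.

Lemma cReM z w : complex.Re (z * w) = complex.Re z * complex.Re w - complex.Im z * complex.Im w.
Proof. by case: z; case: w. Qed.

Lemma cImM z w : complex.Im (z * w) = complex.Re z * complex.Im w + complex.Im z * complex.Re w.
Proof. by case: z; case: w. Qed.

Lemma cRe_sum (I : Type) (r : seq I) (P : pred I) (F : I -> R[i]) :
  complex.Re (\sum_(i <- r | P i) F i) = \sum_(i <- r | P i) complex.Re (F i).
Proof. by elim/big_ind2: _ => // x x' y y' <- <-; rewrite cReD. Qed.

Lemma cIm_sum (I : Type) (r : seq I) (P : pred I) (F : I -> R[i]) :
  complex.Im (\sum_(i <- r | P i) F i) = \sum_(i <- r | P i) complex.Im (F i).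
Proof. by elim/big_ind2: _ => // x x' y y' <- <-; rewrite cImD. Qed.

(** Terms bounded at a larger radius s < 1 are dominated at radius r by a geometric series of ratio
    r / s; the midpoint of r and 1 serves as s. *)
Lemma holoP a : holo a <-> forall r, 0 <= r -> r < 1 -> exists M, forall k, cabs (a k) * r ^+ k <= M.
Proof.
split=> ha r r0 r1.
- have t0 k : 0 <= cabs (a k) * r ^+ k by rewrite mulr_ge0 ?cabs_ge0// exprn_ge0.
  exists (limn (series (fun k => cabs (a k) * r ^+ k))) => k.
  have nd : nondecreasing_seq (series (fun k => cabs (a k) * r ^+ k)).
    by apply/nondecreasing_seqP => m; rewrite !seriesEnat /= big_nat_recr//= lerDl.
  apply: le_trans (nondecreasing_cvgn_le nd (ha r r0 r1) k.+1).
  by rewrite seriesEnat /= big_nat_recr//= lerDr sumr_ge0.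
- pose s := (1 + r) / 2.
  have s0 : 0 < s by rewrite divr_gt0// ltr_pwDl.
  have s1 : s < 1 by rewrite ltr_pdivrMr// mul1r; lra.
  have rs : r < s by rewrite ltr_pdivlMr//; lra.
  have [M hM] := ha s (ltW s0) s1.
  apply: (@series_le_cvg _ _ (geometric M (r / s))).
  - by move=> k; rewrite mulr_ge0 ?sqrtr_ge0// exprn_ge0.
  - move=> k; have := hM 0; rewrite expr0 mulr1 => /(le_trans (cabs_ge0 _)) M0.
    by rewrite mulr_ge0// exprn_ge0// divr_ge0// ltW.
  - move=> k; rewrite /geometric /= expr_div_n mulrA ler_pdivlMr ?exprn_gt0// mulrAC.
    by rewrite ler_wpM2r ?exprn_ge0// hM.
  - apply: is_cvg_geometric_series; rewrite (ger0_norm (divr_ge0 r0 (ltW s0))).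
    by rewrite ltr_pdivrMr// mul1r.
Qed.

Lemma succ_geometric_bound (q : R) k : 0 <= q -> q < 1 -> k.+1%:R * q ^+ k <= (1 - q)^-1.
Proof.
move=> q0 q1; have p : 0 < 1 - q by rewrite subr_gt0.
rewrite -[leRHS]mul1r ler_pdivlMr//.
apply: (@le_trans _ _ ((\sum_(i < k.+1) q ^+ i) * (1 - q))).
  rewrite ler_wpM2r ?(ltW p)//.
  rewrite -[k.+1 in leLHS]card_ord -sumr_const mulr_suml; apply: ler_sum => i _.
  by rewrite mul1r ler_wiXn2l ?(ltW q1)// -ltnS.
have -> : (\sum_(i < k.+1) q ^+ i) * (1 - q) = 1 - q ^+ k.+1.
  by apply: oppr_inj; rewrite opprB subrX1; ring.
by rewrite gerBl exprn_ge0.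
Qed.

(** The factor k+1 is absorbed by passing to a slightly larger radius. This slack is what Cauchy
    products and derivatives cost. *)
Lemma holo_le a (M : R -> R) : 
  (forall r, 0 < r -> r < 1 -> forall k, cabs (a k) * r ^+ k <= M r * k.+1%:R) -> holo a.
Proof.
move=> h; apply/holoP => r r0 r1.
pose s := (1 + r) / 2.
have s0 : 0 < s by rewrite divr_gt0// ltr_pwDl.
have s1 : s < 1 by rewrite ltr_pdivrMr// mul1r; lra.
have rs : r < s by rewrite ltr_pdivlMr//; lra.
have M0 : 0 <= M s.
  by rewrite -[M s]mulr1; apply: le_trans (h s s0 s1 0%N); rewrite mulr_ge0// ?cabs_ge0.
exists (M s * (1 - r / s)^-1) => k.
have q0 : 0 <= r / s by rewrite divr_ge0// ltW.
have q1 : r / s < 1 by rewrite ltr_pdivrMr// mul1r.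
have -> : cabs (a k) * r ^+ k = cabs (a k) * s ^+ k * (r / s) ^+ k.
  by rewrite -mulrA -exprMn mulrCA divff ?mulr1// gt_eqF.
apply: (@le_trans _ _ (M s * k.+1%:R * (r / s) ^+ k)).
  by rewrite ler_wpM2r ?exprn_ge0// h.
by rewrite -mulrA ler_wpM2l// succ_geometric_bound.
Qed.

Lemma holo_bound a : holo a -> exists M : R -> R, forall r, 0 < r -> r < 1 ->
  0 <= M r /\ forall k, cabs (a k) * r ^+ k <= M r.
Proof.
move=> /holoP ha.
have /choice[M hM] : forall r : R, exists m, 0 < r -> r < 1 -> forall k, cabs (a k) * r ^+ k <= m.
  move=> r; have [/andP[r0 r1]|h] := boolP ((0 < r) && (r < 1)).
    by have [m hm] := ha r (ltW r0) r1; exists m.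
  by exists 0 => r0 r1; rewrite r0 r1 in h.
exists M => r r0 r1; split; last exact: hM.
by apply: le_trans (hM r r0 r1 0%N); rewrite mulr_ge0// ?cabs_ge0.
Qed.

Lemma holo_dom a b : (forall k, cabs (b k) <= cabs (a k)) -> holo a -> holo b.
Proof.
move=> h /holo_bound[M hM]; apply: (@holo_le _ M) => r r0 r1 k.
have [M0 hk] := hM r r0 r1.
apply: (@le_trans _ _ (cabs (a k) * r ^+ k)); first by rewrite ler_wpM2r ?exprn_ge0// ltW.
by apply: le_trans (hk k) _; rewrite ler_peMr// ler1n.
Qed.

Lemma holo_bounded a M : (forall k, cabs (a k) <= M) -> holo a.
Proof.
move=> h; have M0 : 0 <= M by apply: le_trans (h 0%N); exact: cabs_ge0.
apply: (@holo_le _ (fun=> M)) => r r0 r1 k.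
rewrite -[leLHS]mul1r mulrCA mul1r ler_pM ?cabs_ge0 ?exprn_ge0 ?(ltW r0)//.
by apply: (@le_trans _ _ 1); [rewrite exprn_ile1// ltW|rewrite ler1n].
Qed.

Lemma holoD a b : holo a -> holo b -> holo (fun k => a k + b k).
Proof.
move=> /holo_bound[M hM] /holo_bound[N hN].
apply: (@holo_le _ (fun r => M r + N r)) => r r0 r1 k.
have [M0 hk] := hM r r0 r1; have [N0 hk'] := hN r r0 r1.
apply: (@le_trans _ _ (M r + N r)); last by rewrite ler_peMr ?addr_ge0// ler1n.
apply: le_trans (lerD (hk k) (hk' k)).
by rewrite -mulrDl ler_wpM2r ?exprn_ge0 ?cabsD// ltW.
Qed.

Lemma holo_pmul a b : holo a -> holo b -> holo (pmul a b).
Proof.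
move=> /holo_bound[M hM] /holo_bound[N hN].
apply: (@holo_le _ (fun r => M r * N r)) => r r0 r1 k.
have [M0 hk] := hM r r0 r1; have [N0 hk'] := hN r r0 r1.
apply: (@le_trans _ _ ((\sum_(i < k.+1) cabs (a i * b (k - i)%N)) * r ^+ k)).
  by rewrite ler_wpM2r ?cabs_sum// exprn_ge0// ltW.
rewrite mulr_suml -[k.+1 in leRHS]card_ord -sumr_const mulr_sumr; apply: ler_sum => i _.
have -> : r ^+ k = r ^+ i * r ^+ (k - i) by rewrite -exprD subnKC// -ltnS.
by rewrite cabsM mulrACA mulr1 ler_pM ?mulr_ge0 ?cabs_ge0 ?exprn_ge0// ltW.
Qed.

Lemma holo_dcoef n a : holo a -> holo (dcoef n a).
Proof.
have holo_deriv b : holo b -> holo (fun k => k.+1%:R * b k.+1).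
  move=> /holo_bound[M hM]; apply: (@holo_le _ (fun r => M r / r)) => r r0 r1 k.
  have [M0 hk] := hM r r0 r1.
  rewrite cabsM cabs_nat -mulrA [leRHS]mulrC ler_wpM2l// ler_pdivlMr//.
  by rewrite -mulrA -exprSr.
elim: n a => [|n IH] a ha.
  by apply: holo_dom ha => k; rewrite /dcoef addn0 ffactn0 mul1r.
apply: holo_dom (holo_deriv _ (IH a ha)) => k; rewrite /dcoef.
have e : (k + n.+1 - n = k.+1)%N by lia.
by rewrite addSnnS mulrA -natrM ffactnSr e mulnC.
Qed.
End power_series.

(** * Evaluation of power series on the disc, tail estimates, measurability *)

Section evaluation.
Variable R : realType.
Implicit Types (a b : nat -> R[i]) (z w : R[i]) (S : nat -> R[i]).
Notation R1 := (measurableTypeR R).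
Notation R2 := (measurableTypeR R * measurableTypeR R)%type.

Definition ccvg S z : Prop :=
  ((fun N => complex.Re (S N)) @ \oo --> complex.Re z) /\
  ((fun N => complex.Im (S N)) @ \oo --> complex.Im z).

Lemma ccvg_unique S z w : ccvg S z -> ccvg S w -> z = w.
Proof.
move=> [h1 h2] [h3 h4].
have e1 : complex.Re z = complex.Re w by apply: cvg_unique h1 h3.
have e2 : complex.Im z = complex.Im w by apply: cvg_unique h2 h4.
by apply/eqP; rewrite eq_complex e1 e2 !eqxx.
Qed.

Lemma ccvgD S S' z w : ccvg S z -> ccvg S' w -> ccvg (fun N => S N + S' N) (z + w).
Proof.
move=> [h1 h2] [h3 h4]; split.
- by rewrite cReD; under eq_fun do rewrite cReD; exact: cvgD.
- by rewrite cImD; under eq_fun do rewrite cImD; exact: cvgD.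
Qed.

Lemma ccvgZ S z w : ccvg S z -> ccvg (fun N => w * S N) (w * z).
Proof.
move=> [h1 h2]; split.
- by rewrite cReM; under eq_fun do rewrite cReM; apply: cvgB; exact: cvgMr.
- by rewrite cImM; under eq_fun do rewrite cImM; apply: cvgD; exact: cvgMr.
Qed.

Lemma ccvg_shift S z : ccvg (fun N => S N.+1) z -> ccvg S z.
Proof. by move=> [h1 h2]; split; rewrite -cvg_shiftS. Qed.

Definition psum a z N : R[i] := \sum_(k < N) a k * z ^+ k.

Lemma peval_ccvg a z : holo a -> cabs z < 1 -> ccvg (psum a z) (peval a z).
Proof.
move=> ha z1; have hz := ha _ (cabs_ge0 z) z1.
have H (f : R[i] -> R) : (forall x, `|f x| <= cabs x) ->
    cvgn (series (fun k => f (a k * z ^+ k))).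
  move=> hf; apply: normed_cvg; apply: series_le_cvg hz => k //=.
  - by rewrite mulr_ge0 ?sqrtr_ge0// exprn_ge0 ?cabs_ge0.
  - by apply: le_trans (hf _) _; rewrite cabsM cabsX.
split; rewrite /psum /=.
- under eq_fun do rewrite cRe_sum -(big_mkord xpredT (fun k => complex.Re (a k * z ^+ k))).
  exact: (H _ (@Re_le_cabs R)).
- under eq_fun do rewrite cIm_sum -(big_mkord xpredT (fun k => complex.Im (a k * z ^+ k))).
  exact: (H _ (@Im_le_cabs R)).
Qed.

Lemma pevalD a b z : holo a -> holo b -> cabs z < 1 ->
  peval (fun k => a k + b k) z = peval a z + peval b z.
Proof.
move=> ha hb z1; apply: ccvg_unique (peval_ccvg (holoD ha hb) z1) _.
have -> : psum (fun k => a k + b k) z = (fun N => psum a z N + psum b z N).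
  by apply/funext => N; rewrite /psum -big_split; apply: eq_bigr => k _; rewrite mulrDl.
by apply: ccvgD; exact: peval_ccvg.
Qed.

Lemma holoZ a (c : R[i]) : holo a -> holo (fun k => c * a k).
Proof.
move=> /holo_bound[M hM]; apply: (@holo_le _ _ (fun r => cabs c * M r)) => r r0 r1 k.
have [M0 hk] := hM r r0 r1.
apply: (@le_trans _ _ (cabs c * M r)); last by rewrite ler_peMr ?mulr_ge0 ?cabs_ge0// ler1n.
by rewrite cabsM -mulrA ler_wpM2l ?cabs_ge0.
Qed.

Lemma pevalZ a (c : R[i]) z : holo a -> cabs z < 1 -> peval (fun k => c * a k) z = c * peval a z.
Proof.
move=> ha z1; apply: ccvg_unique (peval_ccvg (holoZ (c := c) ha) z1) _.
have -> : psum (fun k => c * a k) z = (fun N => c * psum a z N).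
  by apply/funext => N; rewrite /psum mulr_sumr; apply: eq_bigr => k _; rewrite mulrA.
by apply: ccvgZ; exact: peval_ccvg.
Qed.

Lemma peval_rotation a w z : peval a (w * z) = peval (fun k => w ^+ k * a k) z.
Proof.
have e k : a k * (w * z) ^+ k = w ^+ k * a k * z ^+ k by rewrite exprMn mulrCA mulrA.
by rewrite /peval; under eq_fun do rewrite e; under [in X in Complex _ X]eq_fun do rewrite e.
Qed.

Definition shiftr (g : nat -> R[i]) k : R[i] := if k is k'.+1 then g k' else 0.

Lemma holo_shiftr g : holo g -> holo (shiftr g).
Proof.
move=> /holo_bound[M hM]; apply: (@holo_le _ _ M) => r r0 r1 [|k].
  by have [M0 _] := hM r r0 r1; rewrite /shiftr cabs0 mul0r mulr_ge0.
have [M0 hk] := hM r r0 r1; rewrite /shiftr.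
apply: (@le_trans _ _ (M r)); last by rewrite ler_peMr// ler1n.
apply: le_trans (hk k); rewrite ler_wpM2l ?cabs_ge0// ler_wiXn2l// ltW//.
Qed.

Lemma peval_shiftr g z : holo g -> cabs z < 1 -> peval (shiftr g) z = z * peval g z.
Proof.
move=> hg z1; apply: ccvg_unique (peval_ccvg (holo_shiftr hg) z1) _.
apply: ccvg_shift.
have -> : (fun N => psum (shiftr g) z N.+1) = (fun N => z * psum g z N).
  apply/funext => N; rewrite /psum big_ord_recl /= mul0r add0r mulr_sumr.
  by apply: eq_bigr => k _; rewrite /bump /= exprS mulrCA.
by apply: ccvgZ; exact: peval_ccvg.
Qed.

(** Coefficients of (z - lam) g. *)
Definition mulsub (lam : R[i]) (g : nat -> R[i]) k : R[i] := shiftr g k - lam * g k.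

Lemma holo_mulsub lam g : holo g -> holo (mulsub lam g).
Proof.
move=> hg; have -> : mulsub lam g = (fun k => shiftr g k + (- lam) * g k).
  by apply/funext => k; rewrite /mulsub mulNr.
by apply: holoD; [exact: holo_shiftr|exact: holoZ].
Qed.

Lemma peval_mulsub lam g z : holo g -> cabs z < 1 ->
  peval (mulsub lam g) z = (z - lam) * peval g z.
Proof.
move=> hg z1; have -> : mulsub lam g = (fun k => shiftr g k + (- lam) * g k).
  by apply/funext => k; rewrite /mulsub mulNr.
have hs := holo_shiftr hg; have hz := holoZ (c := - lam) hg.
by rewrite (pevalD hs hz z1) (pevalZ _ hg z1) (peval_shiftr hg z1) -mulrDl.
Qed.

Definition trunc N a k : R[i] := if (k < N)%N then a k else 0.

Lemma holo_trunc N a : holo a -> holo (trunc N a).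
Proof. by apply: holo_dom => k; rewrite /trunc; case: ifP => //; rewrite cabs0 cabs_ge0. Qed.

Lemma peval_trunc N a z : holo a -> cabs z < 1 -> peval (trunc N a) z = psum a z N.
Proof.
move=> ha z1; apply: ccvg_unique (peval_ccvg (holo_trunc (N := N) ha) z1) _.
have h M : (N <= M)%N -> psum (trunc N a) z M = psum a z N.
  move=> NM; rewrite /psum -!(big_mkord xpredT (fun k => _ k * z ^+ k)).
  rewrite (big_cat_nat (n := N))//= [X in _ + X]big_nat_cond [X in _ + X]big1 ?addr0.
    by apply: eq_big_nat => k /andP[_ kN]; rewrite /trunc kN.
  by move=> k /andP[/andP[Nk _] _]; rewrite /trunc ltnNge Nk mul0r.
split; apply: cvg_near_cst; exists N => // M NM; rewrite /= h//.
Qed.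

Definition single (r : nat) (c : R[i]) (k : nat) : R[i] := if k == r then c else 0.

Lemma holo_single r c : holo (single r c).
Proof.
apply: (@holo_bounded _ _ (cabs c)) => k; rewrite /single.
by case: ifP => // _; rewrite cabs0 cabs_ge0.
Qed.

Lemma peval_single r c z : cabs z < 1 -> peval (single r c) z = c * z ^+ r.
Proof.
move=> z1; have hs : holo (single r c) by exact: holo_single.
have -> : single r c = trunc r.+1 (single r c).
  by apply/funext => k; rewrite /trunc /single; case: eqP => [->|]; rewrite ?ltnSn// if_same.
rewrite peval_trunc// /psum (bigD1 ord_max)//= /single eqxx big1 ?addr0// => i.
by rewrite -val_eqE /= => /negPf ->; rewrite mul0r.
Qed.

Definition abs_series a z := series (fun k => cabs (a k) * cabs z ^+ k).

(** Here f stands for the real or the imaginary part. A series whose terms vanish before s and are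
    dominated by those of a is at most the tail of the absolute series of a. *)
Lemma peval_tail a d z s (f : R[i] -> R) :
  (forall x y, f (x + y) = f x + f y) -> (forall x, `|f x| <= cabs x) ->
  (f \o psum d z) @ \oo --> f (peval d z) ->
  holo a -> cabs z < 1 -> (forall k, (k < s)%N -> d k = 0) ->
  (forall k, cabs (d k) <= cabs (a k)) ->
  `|f (peval d z)| <= limn (abs_series a z) - abs_series a z s.
Proof.
move=> fD fle cvf ha z1 d0 dle; set T := abs_series a z.
have cT : cvgn T by exact: ha _ (cabs_ge0 z) z1.
have t0 k : 0 <= cabs (a k) * cabs z ^+ k by rewrite mulr_ge0 ?exprn_ge0 ?cabs_ge0.
have nd : nondecreasing_seq T.
  by apply/nondecreasing_seqP => m; rewrite /T /abs_series !seriesEnat /= big_nat_recr//= lerDl.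
have f0 : f 0 = 0 by apply: (addrI (f 0)); rewrite -fD !addr0.
have cn : (fun N => `|f (psum d z N)|) @ \oo --> `|f (peval d z)| by exact: cvg_norm.
have key N : `|f (psum d z N)| <= limn T - T s.
  have [Ns|sN] := leqP N s.
    rewrite /psum big1 ?f0 ?normr0 ?subr_ge0 ?nondecreasing_cvgn_le//.
    by move=> i _; rewrite d0 ?mul0r// (leq_trans (ltn_ord i)).
  apply: (@le_trans _ _ (T N - T s)); last by rewrite lerD2r nondecreasing_cvgn_le.
  apply: le_trans (fle _) _; rewrite /psum /T /abs_series !seriesEnat /=.
  rewrite -(big_mkord xpredT (fun k => d k * z ^+ k)).
  rewrite (big_cat_nat (n := s))//= ?(ltnW sN)//.
  rewrite [X in X + _]big_nat_cond [X in X + _]big1 ?add0r; last first.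
    by move=> k /andP[/andP[_ ks] _]; rewrite d0// mul0r.
  rewrite (big_cat_nat (m := 0%N) (n := s) (p := N))//= ?(ltnW sN)// addrAC subrr add0r.
  apply: le_trans (cabs_sum _ _ _) _; apply: ler_sum => k _.
  by rewrite cabsM cabsX ler_wpM2r ?exprn_ge0 ?cabs_ge0.
have -> : `|f (peval d z)| = limn (fun N => `|f (psum d z N)|) by apply/esym/cvg_lim.
apply: limr_le; first by apply/cvg_ex; exists `|f (peval d z)|.
by near=> N; exact: key.
Unshelve. all: by end_near. Qed.

Lemma peval_tail_cvg a (d : nat -> nat -> R[i]) z :
  holo a -> cabs z < 1 -> (forall s k, (k < s)%N -> d s k = 0) ->
  (forall s k, cabs (d s k) <= cabs (a k)) ->
  ccvg (fun s => peval (d s) z) 0.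
Proof.
move=> ha z1 d0 dle.
pose T := abs_series a z.
have cT : cvgn T by exact: ha _ (cabs_ge0 z) z1.
have c0 : (fun s => limn T - T s) @ \oo --> (0 : R).
  by rewrite -[X in _ --> X](subrr (limn T)); apply: cvgB => //; exact: cvg_cst.
have hd s : holo (d s) by exact: holo_dom (dle s) ha.
split; apply: norm_cvg0; apply: (squeeze_cvgr _ (@cvg_cst _ _ _ _ _) c0); near=> s;
  rewrite normr_ge0 /=.
- apply: (peval_tail (@cReD R) (@Re_le_cabs R) _ ha z1 (d0 s) (dle s)).
  by have [] := peval_ccvg (hd s) z1.
- apply: (peval_tail (@cImD R) (@Im_le_cabs R) _ ha z1 (d0 s) (dle s)).
  by have [] := peval_ccvg (hd s) z1.
Unshelve. all: by end_near. Qed.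

Definition cmeas (F : R2 -> R[i]) : Prop :=
  measurable_fun (@disc R) (fun p : R2 => complex.Re (F p) : R) /\
  measurable_fun (@disc R) (fun p : R2 => complex.Im (F p) : R).

Lemma cmeas_cst c : cmeas (fun=> c).
Proof. by split; exact: measurable_cst. Qed.

Lemma cmeasD F G : cmeas F -> cmeas G -> cmeas (fun p => F p + G p).
Proof.
move=> [h1 h2] [h3 h4]; split.
- by under eq_fun do rewrite cReD; exact: measurable_funD.
- by under eq_fun do rewrite cImD; exact: measurable_funD.
Qed.

Lemma cmeasM F G : cmeas F -> cmeas G -> cmeas (fun p => F p * G p).
Proof.
move=> [h1 h2] [h3 h4]; split.
- by under eq_fun do rewrite cReM; apply: measurable_funB; exact: measurable_funM.
- by under eq_fun do rewrite cImM; apply: measurable_funD; exact: measurable_funM.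
Qed.

Lemma cmeas_zof : cmeas (fun p => zof p).
Proof. by split; apply: measurable_funTS => /=; [exact: measurable_fst|exact: measurable_snd]. Qed.

Lemma disc_cabs (p : R2) : @disc R p -> cabs (zof p) < 1.
Proof. by move=> h; rewrite -[ltRHS]sqrtr1 ltr_sqrt. Qed.

Lemma cmeas_psum a N : cmeas (fun p => psum a (zof p) N).
Proof.
rewrite /psum; elim: N => [|N IH].
  by under eq_fun do rewrite big_ord0; exact: cmeas_cst.
under eq_fun do rewrite big_ord_recr /=.
apply: cmeasD => //; apply: cmeasM; first exact: cmeas_cst.
elim: (N) => [|k IHk]; first by under eq_fun do rewrite expr0; exact: cmeas_cst.
by under eq_fun do rewrite exprS; apply: cmeasM => //; exact: cmeas_zof.
Qed.

Lemma cmeas_peval a : holo a -> cmeas (fun p => peval a (zof p)).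
Proof.
move=> ha; split.
- apply: (@measurable_fun_cvg _ _ _ _ (fun N p => complex.Re (psum a (zof p) N))).
    by move=> N; have [] := cmeas_psum a N.
  by move=> p /disc_cabs p1; have [] := peval_ccvg ha p1.
- apply: (@measurable_fun_cvg _ _ _ _ (fun N p => complex.Im (psum a (zof p) N))).
    by move=> N; have [] := cmeas_psum a N.
  by move=> p /disc_cabs p1; have [] := peval_ccvg ha p1.
Qed.

End evaluation.

(** * Parseval for weighted area integrals *)

Section parseval.
Variable R : realType.
Implicit Types (a b c : nat -> R[i]) (z w : R[i]).
Notation leb2 := ((@lebesgue_measure R \x @lebesgue_measure R)%E).
Notation R1 := (measurableTypeR R).
Notation R2 := (measurableTypeR R * measurableTypeR R)%type.

Lemma csq_ccvg S z : ccvg S z -> (fun N => csq (S N)) @ \oo --> csq z.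
Proof. by move=> [h1 h2]; apply: cvgD; rewrite expr2; under eq_fun do rewrite expr2; exact: cvgM. Qed.

(** Fatou's lemma in the form that serves both halves of Parseval. *)
Lemma fatou_bound (F : nat -> R2 -> R) (F0 : R2 -> R) (S : \bar R) :
  (forall s, measurable_fun (@disc R) (F s)) ->
  (forall s p, @disc R p -> 0 <= F s p) ->
  (forall p, @disc R p -> F s p @[s --> \oo] --> F0 p) ->
  (forall s, \int[leb2]_(p in @disc R) (F s p)%:E <= S)%E ->
  (\int[leb2]_(p in @disc R) (F0 p)%:E <= S)%E.
Proof.
move=> mF F_ge0 cF FS.
rewrite (@eq_integral _ _ _ _ _ (fun p => limn_einf (fun s => (F s p)%:E))); last first.
  move=> p; rewrite inE => /cF cp; apply/esym.
  have ce : (fun s => (F s p)%:E) @ \oo --> (F0 p)%:E by apply: cvg_EFin => //; near=> s.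
  by have [-> _] := cvg_limn_einf_sup ce.
apply: le_trans (fatou leb2 (@measurable_disc R) _ _) _.
- by move=> s; apply/measurable_EFinP; exact: mF.
- by move=> s p dp; rewrite lee_fin F_ge0.
- rewrite limn_einf_lim; apply: lime_le; first exact: is_cvg_einfs.
  near=> s; apply: le_trans (FS s); apply: ereal_inf_lbound; exists s => //=.
Unshelve. all: by end_near. Qed.

Lemma disc_integralD (f g : R2 -> R) :
  measurable_fun (@disc R) f -> measurable_fun (@disc R) g ->
  (forall p, @disc R p -> 0 <= f p) -> (forall p, @disc R p -> 0 <= g p) ->
  (\int[leb2]_(p in @disc R) (f p)%:E + \int[leb2]_(p in @disc R) (g p)%:E =
   \int[leb2]_(p in @disc R) (f p + g p)%:E)%E.
Proof.
move=> mf mg f0 g0; under [RHS]eq_integral do rewrite EFinD.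
rewrite (@ge0_integralD _ _ _ leb2 _ (@measurable_disc R))//.
- by apply/measurable_EFinP; exact: mf.
- by apply/measurable_EFinP; exact: mg.
Qed.

Definition wdens n a (p : R2) : R := csq (peval a (zof p)) * (1 - sqmod p) ^+ n.

Definition wint n a : \bar R := (\int[leb2]_(p in @disc R) (wdens n a p)%:E)%E.

Lemma weight_ge0 n (p : R2) : @disc R p -> 0 <= (1 - sqmod p : R) ^+ n.
Proof. by move=> h; rewrite exprn_ge0// subr_ge0 ltW. Qed.

Lemma wdens_ge0 n a p : @disc R p -> 0 <= wdens n a p.
Proof. by move=> h; rewrite mulr_ge0 ?csq_ge0 ?weight_ge0. Qed.

Lemma measurable_weight n : measurable_fun (@disc R) (fun p : R2 => (1 - sqmod p : R) ^+ n).
Proof.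
apply: measurable_funX; apply: measurable_funB => //.
by apply: measurable_funTS; exact: measurable_sqmod.
Qed.

Lemma measurable_wdens n a : holo a -> measurable_fun (@disc R) (wdens n a).
Proof.
move=> ha; apply: measurable_funM; last exact: measurable_weight.
by have [h1 h2] := cmeas_peval ha; apply: measurable_funD; apply: measurable_funX.
Qed.

Lemma wint_ge0 n a : (0 <= wint n a)%E.
Proof. by apply: integral_ge0 => p dp; rewrite lee_fin wdens_ge0. Qed.

Lemma cabs_unit w : csq w = 1 -> cabs w = 1.
Proof. by rewrite /cabs => ->; rewrite sqrtr1. Qed.

Lemma wint_rotation n a w : holo a -> csq w = 1 -> wint n (fun k => w ^+ k * a k) = wint n a.
Proof.
have nonreal b v : holo b -> csq v = 1 -> complex.Im v != 0 ->
    wint n (fun k => v ^+ k * b k) = wint n b.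
  case: v => x y hb v1 /= y0.
  have mw : measurable_fun (@disc R) (fun p => (wdens n b p)%:E).
    by apply/measurable_EFinP; exact: measurable_wdens.
  have w0 p : @disc R p -> (0 <= (wdens n b p)%:E)%E by move=> h; rewrite lee_fin wdens_ge0.
  rewrite /wint -(disc_integral_rotation y0 v1 mw w0); apply: eq_integral => p _.
  rewrite /wdens zof_rotation peval_rotation.
  by rewrite -(csq_zof (lin2 _ _ _ _ p)) zof_rotation csqM v1 mul1r.
move=> ha w1; have [wr|] := eqVneq (complex.Im w) 0; last exact: nonreal.
have i1 : csq ('i%C : R[i]) = 1 by rewrite /csq /= expr0n expr1n add0r.
have in0 : complex.Im ('i%C : R[i]) != 0 by rewrite /= oner_neq0.
(* The three-shear argument needs a non-real rotation; the real case w = -1 is two successive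
   rotations by i. *)
have : w = 1 \/ w = -1.
  case: w wr w1 => x y /= -> ; rewrite /csq /= expr0n addr0 => /eqP.
  rewrite sqrf_eq1 => /orP[] /eqP ->; first by left.
  by right; apply/eqP; rewrite eq_complex /= oppr0 !eqxx.
move=> [] ->.
  by congr wint; apply/funext => k; rewrite expr1n mul1r.
have hi : holo (fun k => 'i%C ^+ k * a k) by apply: holo_dom ha => k; rewrite cabsM cabsX cabs_unit// expr1n mul1r.
refine (etrans _ (etrans (nonreal _ _ hi i1 in0) (nonreal _ _ ha i1 in0))).
by congr wint; apply/funext => k; rewrite mulrA -exprMn -expr2 sqr_i.
Qed.

Lemma csq_parallelogram z w : csq (z + w) + csq (z - w) = 2 * (csq z + csq w).
Proof. by case: z => x y; case: w => x' y'; rewrite /csq /=; ring. Qed.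

Lemma ereal_double_inj (x y : \bar R) : (0 <= x -> 0 <= y -> x + x = y + y -> x = y)%E.
Proof.
by case: x => [x| |]; case: y => [y| |] //= _ _ [h]; congr EFin; lra.
Qed.

                                                                                           
(** Rotation by w carries b + c to zeta (b - c), so b + c and b - c have the same integral. The
    parallelogram law then gives twice the sum of the integrals of b and c, that is, orthogonality
    of b and c. *)
Lemma wint_split n a b c w zeta : holo b -> holo c -> csq w = 1 -> csq zeta = 1 ->
  (forall k, a k = b k + c k) -> (forall k, w ^+ k * a k = zeta * (b k - c k)) ->
  wint n a = (wint n b + wint n c)%E.
Proof.
move=> hb hc w1 z1 abc wa.
have aE : a = (fun k => b k + c k) by apply/funext.
have ha : holo a by rewrite aE; exact: holoD.
pose c' k := - 1 * c k; have hc' : holo c' by exact: holoZ.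
have hbc : holo (fun k => b k + c' k) by exact: holoD.
have rE : wint n a = wint n (fun k => b k + c' k).
  rewrite -(wint_rotation n ha w1); apply: eq_integral => p; rewrite inE => /disc_cabs p1.
  congr EFin; congr (_ * _).
  rewrite (_ : (fun k => _) = (fun k => zeta * (b k + c' k))); last first.
    by apply/funext => k; rewrite wa /c' mulN1r.
  by rewrite pevalZ// csqM z1 mul1r.
apply: (ereal_double_inj (wint_ge0 n a) (adde_ge0 (wint_ge0 n b) (wint_ge0 n c))).
refine (etrans (congr1 (adde (wint n a)) rE) _).
have m d := measurable_wdens n (a := d); have g0 d := @wdens_ge0 n d.
refine (etrans (disc_integralD (m _ ha) (m _ hbc) (g0 _) (g0 _)) _).
have bcE := disc_integralD (m _ hb) (m _ hc) (g0 _) (g0 _).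
refine (etrans _ (esym (f_equal2 adde bcE bcE))).
refine (etrans _ (esym (disc_integralD _ _ _ _))).
- apply: eq_integral => p; rewrite inE => /disc_cabs p1.
  apply: (congr1 EFin); rewrite /wdens -!mulrDl; apply: (congr1 ( *%R^~ _)).
  rewrite aE (pevalD hb hc p1) (pevalD hb hc' p1) (pevalZ _ hc p1) mulN1r.
  by rewrite csq_parallelogram; ring.
- by apply: measurable_funD; exact: m.
- by apply: measurable_funD; exact: m.
- by move=> p dp; rewrite addr_ge0 ?g0.
- by move=> p dp; rewrite addr_ge0 ?g0.
Qed.

Definition proj (m r : nat) a (k : nat) : R[i] := if (k %% m == r)%N then a k else 0.

Lemma holo_proj m r a : holo a -> holo (proj m r a).
Proof. by apply: holo_dom => k; rewrite /proj; case: ifP => //; rewrite cabs0 cabs_ge0. Qed.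

(** Take iterated square roots of -1; the modulus is 1 because one of its powers is. *)
Lemma dyadic_root s : exists w : R[i], csq w = 1 /\ w ^+ (2 ^ s) = -1.
Proof.
suff [w hw] : exists w : R[i], w ^+ (2 ^ s) = -1.
  exists w; split => //; have : csq w ^+ (2 ^ s) = 1.
    have csqX k : csq (w ^+ k) = csq w ^+ k.
      by elim: k => [|k IH]; rewrite ?exprS ?csqM ?IH// /csq /= expr0n expr1n addr0.
    by rewrite -csqX hw /csq /= oppr0 expr0n sqrrN expr1n addr0.
  by move/eqP; rewrite pexpr_eq1 ?csq_ge0 ?expn_gt0// => /eqP.
elim: s => [|s [w hw]]; first by exists (-1); rewrite expr1.
by exists (sqrtc w); rewrite expnS exprM sqr_sqrtc.
Qed.

Lemma modn_double m k r : (r < m)%N ->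
  (k %% m == r)%N = ((k %% (m + m) == r) || (k %% (m + m) == r + m))%N.
Proof.
move=> rm; have m0 : (0 < m + m)%N by lia.
rewrite -(@modn_dvdm (m + m) k m) ?dvdn_addr//.
have := ltn_pmod k m0; set j := (k %% (m + m))%N => jm.
have [jl|jl] := ltnP j m; first by rewrite modn_small//; lia.
rewrite -(subnK jl) modnDr modn_small; lia.
Qed.

(** For w^(2^s) = -1, the power w^k depends only on k mod 2^(s+1): it is w^r on the class of r and
    -w^r on the class of r + 2^s. So [wint_split] separates the two halves of the class of r mod
    2^s. *)
Lemma wint_proj n s r a : holo a -> (r < 2 ^ s)%N ->
  wint n (proj (2 ^ s) r a) =
  (wint n (proj (2 ^ s + 2 ^ s) r a) + wint n (proj (2 ^ s + 2 ^ s) (r + 2 ^ s) a))%E.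
Proof.
move=> ha rs; have [w [w1 ws]] := dyadic_root s.
have wr1 k : csq (w ^+ k) = 1.
  by rewrite -sqr_cabs cabsX cabs_unit// !expr1n.
apply: (@wint_split _ _ _ _ w (w ^+ r)) => //; try exact: holo_proj.
- move=> k; rewrite /proj modn_double//.
  by case: eqP => [->|_] /=; [rewrite ifF ?addr0//; lia|rewrite add0r].
- move=> k; rewrite /proj modn_double//.
  have wk : w ^+ k = w ^+ (k %% (2 ^ s + 2 ^ s)).
    rewrite {1}(divn_eq k (2 ^ s + 2 ^ s)) exprD mulnC exprM exprD ws.
    by rewrite mulrNN mulr1 expr1n mul1r.
  case: eqP => [e|_] /=; first by rewrite wk e ifF ?subr0//; lia.
  case: eqP => [e|_]; last by rewrite subr0 !mulr0.
  by rewrite wk e exprD ws sub0r mulrN1 mulrN mulNr.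
Qed.

Lemma wint_dyadic n s a : holo a -> wint n a = (\sum_(0 <= r < 2 ^ s) wint n (proj (2 ^ s) r a))%E.
Proof.
move=> ha; elim: s => [|s IH].
  by rewrite expn0 big_nat1; congr wint; apply/funext => k; rewrite /proj modn1.
have halves (F : nat -> \bar R) M :
    (\sum_(0 <= r < M + M) F r = \sum_(0 <= r < M) (F r + F (r + M)%N))%E.
  rewrite (big_cat_nat (n := M)) ?leq_addr//= big_split /=; congr (_ + _)%E.
  by have := big_addn 0%N (M + M) M xpredT F; rewrite add0n addnK.
rewrite IH expnS mul2n -addnn halves.
by apply: eq_big_nat => r /andP[_ rs]; rewrite wint_proj.
Qed.

Definition moment n k : R := area R * ((k`! * n`!)%:R / (k + n).+1`!%:R).

Lemma wdens_monomial n (c : R[i]) r p : @disc R p ->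
  wdens n (single r c) p = csq c * (sqmod p ^+ r * (1 - sqmod p) ^+ n).
Proof.
move=> /disc_cabs p1; rewrite /wdens peval_single// csqM -mulrA; congr (_ * (_ * _)).
by rewrite -!sqr_cabs cabsX -exprM mulnC exprM sqr_cabs csq_zof.
Qed.

Lemma wint_single n (c : R[i]) r : wint n (single r c) = (csq c * moment n r)%:E.
Proof.
rewrite /moment EFinM -radial_moment -ge0_integralZl//; last 4 first.
- exact: measurable_disc.
- apply/measurable_EFinP; apply: measurable_funM; last exact: measurable_weight.
  by apply: measurable_funX; apply: measurable_funTS; exact: measurable_sqmod.
- by move=> p dp; rewrite lee_fin mulr_ge0 ?weight_ge0// exprn_ge0// -csq_zof csq_ge0.
- by rewrite lee_fin csq_ge0.
by apply: eq_integral => p; rewrite inE => dp; rewrite wdens_monomial.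
Qed.

(** Since N < 2^N, each class mod 2^N contains at most one index below N, so the dyadic pieces of
    the truncation are monomials. *)
Lemma wint_trunc n N a : holo a ->
  wint n (trunc N a) = (\sum_(0 <= r < N) csq (a r) * moment n r)%:E.
Proof.
move=> ha; rewrite (wint_dyadic n N (holo_trunc (N := N) ha)).
have N2 : (N < 2 ^ N)%N by exact: ltn_expl.
rewrite (eq_big_nat _ _ (F2 := fun r => (csq (trunc N a r) * moment n r)%:E)); last first.
  move=> r /andP[_ rN]; rewrite -wint_single; congr wint; apply/funext => k.
  rewrite /proj /single /trunc; have [kN|kN] := ltnP k N.
    by rewrite modn_small ?(ltn_trans kN)//; case: eqP => [<-|//]; rewrite kN.
  by rewrite if_same; case: eqP => [<-|//]; rewrite ltnNge kN.
rewrite sumEFin; congr EFin; rewrite (big_cat_nat (n := N)) ?(ltnW N2)//=.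
rewrite [X in _ + X]big_nat_cond [X in _ + X]big1 ?addr0; last first.
  by move=> r /andP[/andP[Nr _] _]; rewrite /trunc ltnNge Nr /csq /= expr0n addr0 mul0r.
by apply: eq_big_nat => r /andP[_ rN]; rewrite /trunc rN.
Qed.

Lemma wint_le n a (S : R) : holo a ->
  (forall N, \sum_(0 <= r < N) csq (a r) * moment n r <= S) -> (wint n a <= S%:E)%E.
Proof.
move=> ha hS; apply: (@fatou_bound (fun N => wdens n (trunc N a))).
- by move=> N; apply: measurable_wdens; exact: holo_trunc.
- by move=> N p; exact: wdens_ge0.
- move=> p /disc_cabs p1; apply: cvgMl; apply: csq_ccvg.
  by under eq_fun do rewrite peval_trunc//; exact: peval_ccvg.
- by move=> N; rewrite -/(wint n (trunc N a)) wint_trunc// lee_fin.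
Qed.

(** The projections of a on the classes r < K mod 2^(s+K) tend pointwise to the monomials of degree
    r as s grows. Their integrals are among the nonnegative terms of the dyadic decomposition of a,
    and Fatou passes to the limit. *)
Lemma wint_ge n a K : holo a -> ((\sum_(0 <= r < K) csq (a r) * moment n r)%:E <= wint n a)%E.
Proof.
move=> ha; pose P s r := proj (2 ^ (s + K)) r a.
have hP s r : holo (P s r) by exact: holo_proj.
have -> : ((\sum_(0 <= r < K) csq (a r) * moment n r)%:E =
    \int[leb2]_(p in @disc R) (\sum_(0 <= r < K) wdens n (single r (a r)) p)%:E)%E.
  under [RHS]eq_integral do rewrite -sumEFin.
  rewrite ge0_integral_sum//; last 3 first.
  - exact: measurable_disc.
  - by move=> r; apply/measurable_EFinP; apply: measurable_wdens; exact: holo_single.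
  - by move=> r p dp; rewrite lee_fin wdens_ge0.
  by rewrite -sumEFin; apply: eq_bigr => r _; rewrite -wint_single.
apply: (@fatou_bound (fun s p => \sum_(0 <= r < K) wdens n (P s r) p)).
- by move=> s; apply: measurable_sum => r; exact: measurable_wdens.
- by move=> s p dp; apply: sumr_ge0 => r _; exact: wdens_ge0.
- move=> p /disc_cabs p1.
  suff cr r : (r < K)%N -> wdens n (P s r) p @[s --> \oo] --> wdens n (single r (a r)) p.
    suff cs k : (k <= K)%N -> \sum_(0 <= r < k) wdens n (P s r) p @[s --> \oo] -->
        \sum_(0 <= r < k) wdens n (single r (a r)) p by exact: cs.
    elim: k => [|k IH] kK.
      by rewrite big_geq//; under eq_fun do rewrite big_geq//; exact: cvg_cst.
    rewrite big_nat_recr//=; under eq_fun do rewrite big_nat_recr//=.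
    by apply: cvgD; [exact: IH (ltnW kK)|exact: cr].
  move=> rK.
  apply: cvgMl; apply: csq_ccvg.
  (* Removing the monomial leaves coefficients that vanish below s and are dominated by those of a,
     so the tail estimate applies. *)
  pose d s k := P s r k + (-1) * single r (a r) k.
  have r2 s : (r < 2 ^ (s + K))%N.
    by apply: leq_trans rK _; apply: leq_trans (leq_addl s K) (ltnW (ltn_expl _ _)).
  have hsg : holo (single r (a r)) by exact: holo_single.
  have hd s : holo (d s) by apply: holoD; [exact: hP|exact: holoZ].
  have PE s : P s r = (fun k => single r (a r) k + d s k).
    by apply/funext => k; rewrite /d mulN1r addrCA subrr addr0.
  have e s : peval (P s r) (zof p) = peval (single r (a r)) (zof p) + peval (d s) (zof p).
    by rewrite {1}PE (pevalD hsg (hd s) p1).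
  under eq_fun do rewrite e.
  rewrite -[X in ccvg _ X]addr0; apply: ccvgD; first by split; exact: cvg_cst.
  apply: (@peval_tail_cvg _ a) => //.
  + move=> s k ks; rewrite /d /P /proj /single modn_small.
      by case: eqP => [->|_]; rewrite ?mulN1r ?subrr// mulr0 addr0.
    by apply: leq_trans ks _; apply: leq_trans (leq_addr K s) (ltnW (ltn_expl _ _)).
  + move=> s k; rewrite /d /single mulN1r; case: eqP => [->|_].
      by rewrite /P /proj modn_small// eqxx subrr cabs0 cabs_ge0.
    by rewrite subr0 /P /proj; case: ifP => // _; rewrite cabs0 cabs_ge0.
- move=> s; under eq_integral do rewrite -sumEFin.
  rewrite ge0_integral_sum//; last 3 first.
  - exact: measurable_disc.
  - by move=> r; apply/measurable_EFinP; exact: measurable_wdens.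
  - by move=> r p dp; rewrite lee_fin wdens_ge0.
  rewrite (wint_dyadic n (s + K) ha).
  have K2 : (K <= 2 ^ (s + K))%N.
    by apply: leq_trans (leq_addl s K) (ltnW (ltn_expl _ _)).
  rewrite [leRHS](big_cat_nat (n := K))//= leeDl//.
  by apply: sume_ge0 => r _; exact: wint_ge0.
Qed.

Lemma wint_finite n a : holo a ->
  (wint n a < +oo)%E <->
  exists S, forall K, \sum_(0 <= k < K) csq (a k) * ((k`! * n`!)%:R / (k + n).+1`!%:R) <= S.
Proof.
move=> ha; have A0 := area_gt0 R.
have e K : \sum_(0 <= k < K) csq (a k) * moment n k =
    area R * \sum_(0 <= k < K) csq (a k) * ((k`! * n`!)%:R / (k + n).+1`!%:R).
  by rewrite mulr_sumr; apply: eq_bigr => k _; rewrite mulrCA.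
split=> [fin|[S hS]].
- have wf : (wint n a) \is a fin_num by rewrite ge0_fin_numE// wint_ge0.
  exists (fine (wint n a) / area R) => K; rewrite ler_pdivlMr// mulrC -e.
  by rewrite -lee_fin fineK// wint_ge.
- apply: (@le_lt_trans _ _ (area R * S)%:E); last by rewrite ltry.
  by apply: wint_le => // N; rewrite e ler_wpM2l// ltW.
Qed.
End parseval.

(** * Quantitative convergence of sequences with finite weighted energy *)

Section weighted_cauchy.
Variable R : realFieldType.

(** Cauchy-Schwarz with weights p and 1/p, where the sum of 1/p from K to M telescopes to u_K - u_M
    <= u_K. It is proved one increment at a time. *)
Lemma cauchy_schwarz_telescope (x p u : nat -> R) (S : R) :
  (forall k, 0 < p k) -> (forall k, 0 < u k) -> (forall k, (p k)^-1 = u k - u k.+1) ->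
  (forall K, \sum_(0 <= k < K) p k * (x k.+1 - x k) ^+ 2 <= S) ->
  forall K M, (K <= M)%N -> (x M - x K) ^+ 2 <= S * u K.
Proof.
move=> p0 u0 pu hS K M KM.
have t0 k : 0 <= p k * (x k.+1 - x k) ^+ 2 by rewrite mulr_ge0 ?sqr_ge0// ltW.
pose X M := \sum_(K <= k < M) p k * (x k.+1 - x k) ^+ 2.
have X0 N : 0 <= X N by apply: sumr_ge0 => k _.
have key d : (x (K + d)%N - x K) ^+ 2 <= X (K + d)%N * (u K - u (K + d)%N) /\ u (K + d)%N <= u K.
  elim: d => [|d [IH ud]]; first by rewrite addn0 !subrr expr0n mulr0.
  rewrite addnS /X big_nat_recr ?leq_addr//= -/(X _).
  set N := (K + d)%N in IH ud *.
  have q0 : 0 < (p N)^-1 by rewrite invr_gt0.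
  have -> : u K - u N.+1 = (u K - u N) + (p N)^-1 by rewrite pu; ring.
  split; last by apply: le_trans ud; rewrite -subr_ge0 -pu ltW.
  have -> : x N.+1 - x K = (x N - x K) + (x N.+1 - x N) by ring.
  set a := x N - x K in IH *; set b := x N.+1 - x N; set Y := u K - u N in IH *.
  have Y0 : 0 <= Y by rewrite subr_ge0.
  set q := (p N)^-1 in q0 *.
  have Pq : p N * q = 1 by rewrite divff// gt_eqF.
  have U0 : 0 <= X N * q by rewrite mulr_ge0// ltW.
  have V0 : 0 <= p N * b ^+ 2 * Y by rewrite mulr_ge0// mulr_ge0 ?sqr_ge0// ltW.
  have UV : (a * b) ^+ 2 <= (X N * q) * (p N * b ^+ 2 * Y).
    have -> : (X N * q) * (p N * b ^+ 2 * Y) = (p N * q) * ((X N * Y) * b ^+ 2) by ring.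
    by rewrite Pq mul1r exprMn ler_wpM2r ?sqr_ge0.
  (* The cross term is controlled by 2 sqrt(UV) <= U + V, stated without square roots. *)
  have ab : 2 * (a * b) <= X N * q + p N * b ^+ 2 * Y.
    move: UV U0 V0; set U := X N * q; set V := p N * b ^+ 2 * Y; set c := a * b => UV U0 V0.
    have h : 0 <= (U - V) ^+ 2 by exact: sqr_ge0.
    by nra.
  have -> : (X N + p N * b ^+ 2) * (Y + q) =
      X N * Y + (X N * q + p N * b ^+ 2 * Y) + (p N * q) * b ^+ 2 by ring.
  by rewrite Pq mul1r; nra.
rewrite -(subnKC KM); have [h _] := key (M - K)%N; apply: le_trans h _.
have XS : X (K + (M - K))%N <= S.
  apply: le_trans (hS (K + (M - K))%N); rewrite [leRHS](big_cat_nat (n := K)) ?leq_addr//=.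
  by rewrite lerDr sumr_ge0.
apply: (@le_trans _ _ (X (K + (M - K))%N * u K)).
  by rewrite ler_wpM2l// gerBl ltW.
by rewrite ler_wpM2r// ltW.
Qed.
End weighted_cauchy.

Section limit_constant.
Variable R : realType.

(** The intervals of radius sqrt(e_k) about x_k meet pairwise, up to monotonicity of e, in such a
    way that every upper end bounds every lower end; L is the supremum of the lower ends. *)
Lemma cauchy_limit (x e : nat -> R) :
  (forall k, 0 <= e k) -> (forall k, e k.+1 <= e k) ->
  (forall K M, (K <= M)%N -> (x M - x K) ^+ 2 <= e K) ->
  exists L, forall K, (x K - L) ^+ 2 <= e K.
Proof.
move=> e0 ed h.
have dist K M : (K <= M)%N -> `|x M - x K| <= Num.sqrt (e K).
  by move=> /h KM; rewrite -sqrtr_sqr ler_wsqrtr.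
have em K M : (K <= M)%N -> Num.sqrt (e M) <= Num.sqrt (e K).
  elim: M => [|M IH]; first by rewrite leqn0 => /eqP ->.
  rewrite leq_eqVlt => /orP[/eqP -> //|/IH]; apply: le_trans.
  by rewrite ler_wsqrtr.
pose E := [set y | exists k, y = x k - Num.sqrt (e k)].
have ub K : ubound E (x K + Num.sqrt (e K)).
  move=> _ [M ->]; rewrite lerBlDr; have [KM|/ltnW MK] := leqP K M.
    have := dist _ _ KM; rewrite ler_norml => /andP[_ d]; rewrite lerBlDl in d.
    by apply: le_trans d _; rewrite lerDl sqrtr_ge0.
  have := dist _ _ MK; rewrite ler_norml => /andP[d _].
  have := sqrtr_ge0 (e K); have := sqrtr_ge0 (e M); lra.
have hE : has_sup E by split; [exists (x 0%N - Num.sqrt (e 0%N)); exists 0%N|exists (x 0%N + Num.sqrt (e 0%N)); exact: ub].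
exists (sup E) => K; rewrite -(sqr_sqrtr (e0 K)) -(real_normK (num_real (x K - sup E))).
rewrite ler_sqr ?nnegrE ?normr_ge0 ?sqrtr_ge0// ler_norml; apply/andP; split.
- by have : sup E <= x K + Num.sqrt (e K); [apply: ge_sup; [exact: hE.1|exact: ub]|lra].
- by have : x K - Num.sqrt (e K) <= sup E; [apply: ub_le_sup; [exact: hE.2|exists K]|lra].
Qed.
End limit_constant.

(** * Dividing by z - lam: coefficients of the quotient f^{(m+1)} / (z - lam) *)

Section local_dirichlet.
Variable R : realType.
Implicit Types (f g G : nat -> R[i]) (lam : R[i]).

(** As |lam| = 1, solving for G gives |G_k| at most the sum of the moduli of the first k+1
    coefficients of (z - lam) G, a loss that [holo_le] absorbs. *)
Lemma holo_mulsub_inv lam G : csq lam = 1 -> holo (mulsub lam G) -> holo G.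
Proof.
move=> lam1 /holo_bound[M hM].
have lamG k : cabs (lam * G k) = cabs (G k) by rewrite cabsM cabs_unit// mul1r.
have le k : cabs (G k) <= \sum_(j < k.+1) cabs (mulsub lam G j).
  elim: k => [|k IH].
    by rewrite big_ord1 /mulsub /= sub0r cabsN lamG.
  rewrite big_ord_recr /= -(lamG k.+1).
  have -> : lam * G k.+1 = G k - mulsub lam G k.+1 by rewrite /mulsub /= opprB addrC subrK.
  by apply: le_trans (cabsD _ _) _; rewrite cabsN lerD2r.
apply: (@holo_le _ _ M) => r r0 r1 k; have [M0 hk] := hM r r0 r1.
apply: (@le_trans _ _ ((\sum_(j < k.+1) cabs (mulsub lam G j)) * r ^+ k)).
  by rewrite ler_wpM2r ?exprn_ge0// ltW.
rewrite mulr_suml -[k.+1 in leRHS]card_ord -sumr_const mulr_sumr; apply: ler_sum => j _.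
rewrite mulr1; apply: le_trans (hk j).
by rewrite ler_wpM2l ?cabs_ge0// ler_wiXn2l ?(ltW r0) ?(ltW r1)// -ltnS.
Qed.

(** Says f = const + (z - lam) g: the coefficient of index 0 is left free. *)
Definition rep lam f g : Prop := forall k, f k.+1 = g k - lam * g k.+1.

(** Partial sums at the boundary point lam of the Taylor series of g^{(m)}. *)
Definition tsum m lam g k : R[i] := \sum_(j < k.+1) lam ^+ j * ((j + m) ^_ m)%:R * g (j + m)%N.

Definition numer m lam g k : R[i] := k.+1%:R * tsum m lam g k.+1 - (k.+2 + m)%:R * tsum m lam g k.

(** Coefficients of g^{(m+1)} + (m+1) g^{(m)} / (z - lam). Division by z - lam yields -lam^{-k-1}
    T_k, and g^{(m+1)} contributes (k+1) lam^{-k-1} (T_{k+1} - T_k), with T = [tsum m lam g]. *)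
Definition quotient m lam g k : R[i] := lam^-1 ^+ k.+1 * numer m lam g k.

Lemma csq1_neq0 lam : csq lam = 1 -> lam != 0.
Proof. by move=> h; apply/eqP => l0; move/eqP: h; rewrite l0 /csq /= expr0n addr0 eq_sym oner_eq0. Qed.

Lemma tsumS m lam g k :
  tsum m lam g k.+1 = tsum m lam g k + lam ^+ k.+1 * ((k.+1 + m) ^_ m)%:R * g (k.+1 + m)%N.
Proof. by rewrite /tsum big_ord_recr. Qed.

(** Leibniz' rule ((z - lam) g)^{(m+1)} = (z - lam) g^{(m+1)} + (m+1) g^{(m)}, checked on
    coefficients after multiplication by lam^k. *)
Lemma dcoef_rep m lam f g : csq lam = 1 -> rep lam f g ->
  forall k, dcoef m.+1 f k = mulsub lam (quotient m lam g) k.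
Proof.
move=> lam1 fg k; have l0 := csq1_neq0 lam1.
have lE j : lam ^+ j * lam^-1 ^+ j = 1 by rewrite -exprMn mulfV// expr1n.
have qE j : lam ^+ j * (lam * quotient m lam g j) = numer m lam g j.
  by rewrite /quotient !mulrA -exprSr lE mul1r.
apply: (mulfI (expf_neq0 k l0)); rewrite /dcoef /mulsub mulrBr qE.
case: k => [|k].
  rewrite expr0 !mul1r sub0r add0n /numer fg ffactnn.
  rewrite tsumS /tsum big_ord1 expr0 expr1 mul1r add0n ffactnn.
  have -> : ((m.+1)`!)%:R = (m.+1)%:R * (m`!)%:R :> R[i] by rewrite factS natrM.
  have -> : ((1 + m) ^_ m)%:R = (m.+1)%:R * (m`!)%:R :> R[i].
    rewrite -natrM -factS -(ffactnn m.+1) ffactnSr add1n (_ : m.+1 - m = 1)%N ?muln1//; lia.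
  have -> : (2 + m)%N%:R = (m.+1)%:R + 1 :> R[i] by rewrite natr1.
  by rewrite add1n; ring.
rewrite [shiftr _ _]/= /quotient [in X in _ = X - _]mulrA lE mul1r /numer !tsumS addnS fg.
set T := tsum m lam g k.
have e1 : ((k.+1 + m).+1 ^_ m.+1 = (k.+2 + m) * (k.+1 + m) ^_ m)%N by rewrite ffactSS.
have e2 : ((k.+1 + m).+1 ^_ m.+1 = (k.+2 + m) ^_ m * k.+2)%N.
  by rewrite ffactnSr (_ : (k.+1 + m).+1 - m = k.+2)%N//; lia.
have e3 : ((k.+2 + m) * (k.+1 + m) ^_ m)%N%:R = ((k.+2 + m) ^_ m)%:R * k.+2%:R :> R[i].
  by rewrite -e1 e2 natrM.
rewrite e1 mulrBr {2}e3 natrM.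
have -> : (k.+3 + m)%N%:R = (k.+2 + m)%:R + 1 :> R[i] by rewrite -natr1 addSn.
have -> : k.+2%:R = k.+1%:R + 1 :> R[i] by rewrite -natr1.
have -> : (k.+2 + m)%N = (k.+1 + m).+1 by [].
have -> : lam ^+ k.+2 = lam ^+ k.+1 * lam by rewrite exprSr.
set P := ((k.+1 + m) ^_ m)%:R; set Q := (((k.+1 + m).+1) ^_ m)%:R.
have -> : ((k.+1 + m).+1%:R = k.+2%:R + m%:R :> R[i]) by rewrite -natrD.
have -> : k.+2%:R = k.+1%:R + 1 :> R[i] by rewrite -natr1.
ring.
Qed.
End local_dirichlet.

(** * Energy identity between the quotient and the norm of H_{sigma,m} *)

Section energy.
Variable R : realType.
Implicit Types (f g G : nat -> R[i]) (lam : R[i]).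

Lemma csq_nat n (z : R[i]) : csq (n%:R * z) = n%:R ^+ 2 * csq z.
Proof. by rewrite csqM -(sqr_cabs n%:R) cabs_nat. Qed.

Definition wgt m k : nat := 'C(k + m.+1, m.+1).

Lemma wgt_gt0 m k : (0 < wgt m k)%N.
Proof. by rewrite bin_gt0 leq_addl. Qed.

Lemma wgtS m k : (wgt m k.+1 = wgt m k + 'C(k.+1 + m, m))%N.
Proof. by rewrite /wgt addSn binS addSnnS. Qed.

Lemma wgt_succ m k : (k.+1 * wgt m k.+1 = (k.+2 + m) * wgt m k)%N.
Proof.
rewrite /wgt; have := mul_bin_down (k.+1 + m.+1) m.+1.
by rewrite addnK addSn /= => <-; rewrite addnS addSn.
Qed.

Lemma wgt_diff m k : (m.+1 * wgt m k.+1 = (k.+2 + m) * 'C(k.+1 + m, m))%N.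
Proof. by rewrite /wgt -mul_bin_diag addnS /= addSn. Qed.

(** Weighted mean of m! lam^j g_{j+m} over j <= k, with weights C(j+m,m); [wgt m k] is their total
    by the hockey-stick identity. *)
Definition avg m lam g k : R[i] := (wgt m k)%:R^-1 * tsum m lam g k.

Lemma wgtC_neq0 m k : (wgt m k)%:R != 0 :> R[i].
Proof. by rewrite pnatr_eq0 -lt0n wgt_gt0. Qed.

Lemma tsum_avg m lam g k : tsum m lam g k = (wgt m k)%:R * avg m lam g k.
Proof. by rewrite /avg mulrA mulfV ?mul1r// wgtC_neq0. Qed.

(** The relation (k+1) W_{k+1} = (k+m+2) W_k makes the two terms of [numer] carry the same
    factor. *)
Lemma numerE m lam g k : numer m lam g k =
  ((k.+2 + m) * wgt m k)%:R * (avg m lam g k.+1 - avg m lam g k).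
Proof.
by rewrite /numer (tsum_avg _ _ _ k.+1) (tsum_avg _ _ _ k) !mulrA -!natrM wgt_succ mulrBr /avg !mulrA.
Qed.

Definition jump m lam g k : R :=
  ((k.+2 + m) * wgt m k)%:R * csq (avg m lam g k.+1 - avg m lam g k).

Lemma fact_wgt m k : ((k + m.+1)`! = wgt m k * (k`! * (m.+1)`!))%N.
Proof. by rewrite -(bin_fact (leq_addl k m.+1)) addnK (mulnC k`!). Qed.

Lemma quotient_energy m lam g k : csq lam = 1 ->
  csq (quotient m lam g k) * ((k`! * (m.+1)`!)%:R / (k + m.+1).+1`!%:R) = jump m lam g k.
Proof.
move=> lam1; have li : csq (lam^-1 ^+ k.+1) = 1.
  have h : csq lam^-1 = 1.
    have : csq (lam * lam^-1) = 1 by rewrite mulfV ?csq1_neq0// /csq /= expr0n expr1n addr0.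
    by rewrite csqM lam1 mul1r.
  by rewrite -sqr_cabs cabsX cabs_unit// !expr1n.
rewrite /quotient csqM li mul1r numerE csq_nat /jump (factS (k + m.+1)) fact_wgt.
have -> : (k + m.+1).+1 = (k.+2 + m)%N by lia.
have := fact_gt0 m.+1; have := fact_gt0 k; have := wgt_gt0 m k.
have : (0 < k.+2 + m)%N by [].
move: (csq _) (m.+1)`! k`! (wgt m k) (k.+2 + m)%N => x a b c d.
rewrite !lt0n -!(pnatr_eq0 R) => d0 c0 b0 a0; rewrite !natrM.
by field; rewrite ?a0 ?b0 ?c0 ?d0.
Qed.

Lemma csq_weighted (w w' : R) (z z' : R[i]) :
  csq (Complex w' 0 * z' - Complex w 0 * z) =
  w * w' * csq (z' - z) + (w' - w) * (w' * csq z' - w * csq z).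
Proof. by case: z => x y; case: z' => x' y'; rewrite /csq /=; ring. Qed.

Lemma natC (n : nat) : n%:R = Complex (n%:R : R) 0.
Proof. by rewrite -[RHS]/(real_complex R n%:R) rmorph_nat. Qed.

(** The terms of [Dsig m g], reindexed to start at 0. *)
Definition hterm m g k : R := ('C(k + m, m))%:R * csq (g (k + m)%N).

(** With d = W_{k+1} - W_k, the increment of T = W A has squared modulus m!^2 d^2 |g_{k+1+m}|^2.
    Expanding it by [csq_weighted] and cancelling d through (m+1) W_{k+1} = (k+m+2) d gives the jump
    plus a telescoping difference. *)
Lemma energy_step m lam g k : csq lam = 1 ->
  (m`! ^ 2 * m.+1)%:R * hterm m g k.+1 =
  jump m lam g k + m.+1%:R * ((wgt m k.+1)%:R * csq (avg m lam g k.+1) - (wgt m k)%:R * csq (avg m lam g k)).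
Proof.
move=> lam1; rewrite /hterm /jump.
have d0 : ('C(k.+1 + m, m))%:R != 0 :> R by rewrite pnatr_eq0 -lt0n bin_gt0 leq_addl.
apply: (mulfI d0).
have W' : (wgt m k.+1)%:R = (wgt m k)%:R + ('C(k.+1 + m, m))%:R :> R by rewrite wgtS natrD.
have E : m.+1%:R * (wgt m k.+1)%:R = (k.+2 + m)%:R * ('C(k.+1 + m, m))%:R :> R.
  by rewrite -!natrM wgt_diff.
have T : csq (tsum m lam g k.+1 - tsum m lam g k) =
    ('C(k.+1 + m, m))%:R ^+ 2 * (m`!)%:R ^+ 2 * csq (g (k.+1 + m)%N).
  rewrite tsumS addrC addKr -bin_ffact !csqM natrM csq_nat.
  have -> : csq (lam ^+ k.+1) = 1 by rewrite -sqr_cabs cabsX cabs_unit// !expr1n.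
  by rewrite -(sqr_cabs (m`!)%:R) cabs_nat mul1r.
rewrite (tsum_avg _ _ _ k.+1) (tsum_avg _ _ _ k) !natC csq_weighted in T.
set d := ('C(k.+1 + m, m))%:R in d0 W' E T *; set c := csq (avg m lam g k.+1 - avg m lam g k) in T *.
set A' := csq (avg m lam g k.+1) in T *; set A := csq (avg m lam g k) in T *.
set h := csq (g (k.+1 + m)%N) in T *.
rewrite (natrM _ (m`! ^ 2)) natrX (natrM _ (k.+2 + m)).
have -> : d * ((m`!)%:R ^+ 2 * m.+1%:R * (d * h)) = m.+1%:R * (d ^+ 2 * (m`!)%:R ^+ 2 * h) by ring.
rewrite -T {2}W'.
have -> : (wgt m k)%:R + d - (wgt m k)%:R = d by rewrite addrC addKr.
rewrite mulrDr [in RHS]mulrDr; congr (_ + _); last by ring.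
have -> : d * ((k.+2 + m)%:R * (wgt m k)%:R * c) = ((k.+2 + m)%:R * d) * ((wgt m k)%:R * c) by ring.
by rewrite -E; ring.
Qed.

Lemma energy_identity m lam g K : csq lam = 1 ->
  (m`! ^ 2 * m.+1)%:R * (\sum_(0 <= k < K.+1) hterm m g k) =
  \sum_(0 <= k < K) jump m lam g k + m.+1%:R * ((wgt m K)%:R * csq (avg m lam g K)).
Proof.
move=> lam1; elim: K => [|K IH].
  rewrite big_nat1 big_geq// add0r /hterm /avg /wgt !add0n !binn invr1 !mul1r /tsum big_ord1.
  by rewrite expr0 mul1r !add0n ffactnn csq_nat (natrM _ (m`! ^ 2)) natrX; ring.
rewrite big_nat_recr//= mulrDr IH (@energy_step m lam g K lam1) [in RHS]big_nat_recr//=; ring.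
Qed.

Lemma Dsig_finite m (a : nat -> R[i]) :
  (Dsig m a < +oo)%E <-> exists S, forall K, \sum_(0 <= k < K) hterm m a k <= S.
Proof.
pose u k : \bar R := (('C(k, m))%:R * csq (a k))%:E.
have u0 k : (0 <= u k)%E by rewrite lee_fin mulr_ge0 ?csq_ge0.
have part K : (\sum_(m <= k < K + m) u k)%E = (\sum_(0 <= k < K) hterm m a k)%:E.
  by rewrite -{1}[m]add0n big_addn addnK sumEFin.
have le K : ((\sum_(0 <= k < K) hterm m a k)%:E <= Dsig m a)%E.
  by rewrite -part; apply: nneseries_lim_ge => k _ _; exact: u0.
split=> [fin|[S hS]].
- have D0 : (0 <= Dsig m a)%E by apply: nneseries_ge0 => k _ _; exact: u0.
  exists (fine (Dsig m a)) => K; rewrite -lee_fin fineK//.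
  by rewrite ge0_fin_numE.
- apply: (@le_lt_trans _ _ S%:E); last by rewrite ltry.
  apply: lime_le; first by apply: is_cvg_nneseries => k _ _; exact: u0.
  near=> N; have Nm : (m <= N)%N by near: N; exists m.
  by rewrite -(subnK Nm) -[X in (X <= _)%E]/(\sum_(m <= k < _) u k)%E part lee_fin.
Unshelve. all: by end_near. Qed.
End energy.

(** * The local Douglas description of H_{lam,m+1} *)

Section local_douglas.
Variable R : realType.
Implicit Types (f g G : nat -> R[i]) (lam : R[i]).
Local Open Scope complex_scope.

(** The factor |z - lam|^2 of |f^{(m+1)}|^2 cancels the denominator of the Poisson-type weight,
    which leaves (1 - |z|^2)^{m+1}. *)
Lemma Dlam_finite m lam f G : csq lam = 1 -> holo G ->
  (forall k, dcoef m.+1 f k = mulsub lam G k) ->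
  (Dlam m.+1 lam f < +oo)%E <-> (wint m.+1 G < +oo)%E.
Proof.
move=> lam1 hG fG.
have -> : Dlam m.+1 lam f = ((((m.+1)`! * m`!)%:R^-1 * pi^-1)%:E * wint m.+1 G)%E.
  congr (_ * _)%E; apply: eq_integral => p; rewrite inE => dp.
  have p1 := disc_cabs dp; apply: (congr1 EFin).
  rewrite /Dlam_integrand /wdens -/(zof p) csq_zof /pderiv.
  have -> : dcoef m.+1 f = mulsub lam G by apply/funext.
  rewrite peval_mulsub// csqM exprS /=.
  have z0 : csq (zof p - lam) != 0.
    apply/eqP => h; have e : zof p = lam.
      apply/eqP; rewrite -subr_eq0; move: h; case: (zof p - lam) => x y /eqP.
      rewrite /csq /= paddr_eq0 ?sqr_ge0// !sqrf_eq0 => /andP[x0 y0].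
      by rewrite eq_complex /= x0 y0.
    by move: dp; rewrite /disc /= -[X in X < 1]/(csq (zof p)) e lam1 ltxx.
  move: (csq (zof p - lam)) z0 (csq (peval G (zof p))) (sqmod p) => d d0 x y.
  by field.
have c0 : 0 < ((m.+1)`! * m`!)%:R^-1 * pi^-1 :> R.
  by rewrite mulr_gt0// invr_gt0 ?pi_gt0// ltr0n muln_gt0 !fact_gt0.
split=> h; last first.
  by apply: lte_mul_pinfty => //; rewrite lee_fin ltW.
have w0 := wint_ge0 m.+1 G.
by case: (wint m.+1 G) w0 h => [r _ _|_|//]; rewrite ?ltry// gt0_muley ?lte_fin.
Qed.

Definition hnorm_bounded m g := exists S, forall K, \sum_(0 <= k < K) hterm m g k <= S.

Lemma hterm_ge0 m g k : 0 <= hterm m g k.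
Proof. by rewrite mulr_ge0 ?csq_ge0. Qed.

Lemma hnorm_square_summable m g : hnorm_bounded m g ->
  exists S, forall K, \sum_(0 <= k < K) csq (g k) <= S.
Proof.
move=> [S hS]; exists (\sum_(0 <= k < m) csq (g k) + S) => K.
apply: (@le_trans _ _ (\sum_(0 <= k < K + m) csq (g k))).
  rewrite [leRHS](big_cat_nat (n := K)) ?leq_addr//= lerDl sumr_ge0// => k _.
  exact: csq_ge0.
rewrite (big_cat_nat (n := m)) ?leq_addl//= lerD2l.
rewrite -{1}[m]add0n big_addn addnK; apply: le_trans (hS K); apply: ler_sum => k _.
by rewrite /hterm ler_peMl ?csq_ge0// ler1n bin_gt0 leq_addl.
Qed.

Lemma hnorm_holo m g : hnorm_bounded m g -> holo g.
Proof.
move=> /hnorm_square_summable[S hS]; apply: (@holo_bounded _ _ (Num.sqrt S)) => k.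
rewrite ler_wsqrtr//; apply: le_trans (hS k.+1).
by rewrite big_nat_recr//= lerDr sumr_ge0// => j _; exact: csq_ge0.
Qed.

Lemma HsigP m g : Hsig m g <-> hnorm_bounded m g.
Proof.
split=> [[_] /Dsig_finite //|h]; split; first exact: hnorm_holo h.
exact/Dsig_finite.
Qed.

Lemma rep_exists lam f : csq lam = 1 -> exists g, rep lam f g.
Proof.
move=> lam1; pose g := fix g k := if k is k'.+1 then lam^-1 * (g k' - f k) else 0.
exists g => k; rewrite [g k.+1]/= mulrA mulfV ?csq1_neq0// mul1r.
by rewrite opprB addrC subrK.
Qed.

Lemma rep_holo_quotient m lam f g : csq lam = 1 -> holo f -> rep lam f g ->
  holo (quotient m lam g).
Proof.
move=> lam1 hf fg; apply: (holo_mulsub_inv lam1).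
have -> : mulsub lam (quotient m lam g) = dcoef m.+1 f.
  by apply/funext => k; rewrite (dcoef_rep m lam1 fg).
exact: holo_dcoef.
Qed.

Lemma Dlam_jump m lam f g : csq lam = 1 -> holo f -> rep lam f g ->
  (Dlam m.+1 lam f < +oo)%E <->
  exists S, forall K, \sum_(0 <= k < K) jump m lam g k <= S.
Proof.
move=> lam1 hf fg; have hG := @rep_holo_quotient m _ _ _ lam1 hf fg.
apply: iff_trans (Dlam_finite lam1 hG (dcoef_rep m lam1 fg)) _.
apply: iff_trans (wint_finite m.+1 hG) _.
have e K : \sum_(0 <= k < K) csq (quotient m lam g k) *
    ((k`! * (m.+1)`!)%:R / (k + m.+1).+1`!%:R) = \sum_(0 <= k < K) jump m lam g k.
  by apply: eq_bigr => k _; exact: quotient_energy.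
by split=> -[S hS]; exists S => K; move: (hS K); rewrite e.
Qed.

(** The geometric sequence lam^{-k} is killed by z - lam up to a constant, and all its averages are
    equal. The multiple c is normalised so that this common average is L. *)
Lemma rep_shift m lam g (L : R[i]) : csq lam = 1 -> exists g',
  (forall f, rep lam f g -> rep lam f g') /\
  (forall k, avg m lam g' k = avg m lam g k - L).
Proof.
move=> lam1; have l0 := csq1_neq0 lam1.
have m0 : (m`!)%:R != 0 :> R[i] by rewrite pnatr_eq0 -lt0n fact_gt0.
have li j : lam ^+ j * lam^-1 ^+ j = 1 by rewrite -exprMn mulfV// expr1n.
pose c := L * lam ^+ m / (m`!)%:R.
exists (fun k => g k - c * lam^-1 ^+ k); split.
  move=> f fg k; have h : lam * (c * lam^-1 ^+ k.+1) = c * lam^-1 ^+ k.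
    by rewrite exprS mulrCA (mulrA lam) mulfV// mul1r.
  by rewrite fg mulrBr h; ring.
have T k : tsum m lam (fun k => g k - c * lam^-1 ^+ k) k = tsum m lam g k - (wgt m k)%:R * L.
  have cE j : lam ^+ j * ((j + m) ^_ m)%:R * (c * lam^-1 ^+ (j + m)) = ('C(j + m, m))%:R * L.
    rewrite -bin_ffact natrM exprD /c.
    transitivity (('C(j + m, m))%:R * L * ((lam ^+ j * lam^-1 ^+ j) * (lam ^+ m * lam^-1 ^+ m)) * ((m`!)%:R / (m`!)%:R)).
      by rewrite !exprVn; field; rewrite ?m0 ?expf_neq0.
    by rewrite !li divff// !mulr1.
  elim: k => [|k IH].
    rewrite /tsum !big_ord1 mulrBr cE /wgt !add0n !binn; ring.
  rewrite !tsumS IH mulrBr cE wgtS natrD; ring.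
by move=> k; rewrite /avg T mulrBr (mulrA _ _ L) mulVf ?wgtC_neq0// mul1r.
Qed.

(** The jump weights divided by m+1 have reciprocals 1/W_k - 1/W_{k+1}, so the telescoping
    Cauchy-Schwarz bound yields |A_K - L|^2 = O(1/W_K). *)
Lemma jump_limit m lam g S : (forall K, \sum_(0 <= k < K) jump m lam g k <= S) ->
  exists L S', forall K, (wgt m K)%:R * csq (avg m lam g K - L) <= S'.
Proof.
move=> hS; pose p k : R := ((k.+2 + m) * wgt m k)%:R / m.+1%:R.
pose u k : R := (wgt m k)%:R^-1.
have w0 k : 0 < (wgt m k)%:R :> R by rewrite ltr0n wgt_gt0.
have m0 : 0 < m.+1%:R :> R by rewrite ltr0n.
have p0 k : 0 < p k by rewrite divr_gt0// ltr0n muln_gt0 wgt_gt0 addSn.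
have u0 k : 0 < u k by rewrite invr_gt0.
have pu k : (p k)^-1 = u k - u k.+1.
  have E : m.+1%:R * (wgt m k.+1)%:R = (k.+2 + m)%:R * ((wgt m k.+1)%:R - (wgt m k)%:R) :> R.
    by rewrite -natrM wgt_diff natrM wgtS (natrD _ (wgt m k)) addrAC subrr add0r.
  rewrite /p /u natrM invf_div.
  have := w0 k; have := w0 k.+1; move: E.
  have : (k.+2 + m)%:R != 0 :> R by rewrite pnatr_eq0 addSn.
  move: (k.+2 + m)%:R (wgt m k.+1)%:R (wgt m k)%:R => a w' w a0 E w'0 w'1.
  apply: (mulIf (lt0r_neq0 w'0)); rewrite mulrAC E.
  by field; rewrite a0 !gt_eqF.
(* The convergence lemmas are real, so they are applied to the real and imaginary parts
   separately. *)
have part (F : R[i] -> R) : (forall z w, F (z - w) = F z - F w) ->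
    (forall z, F z ^+ 2 <= csq z) -> exists L, forall K, (F (avg m lam g K) - L) ^+ 2 <= S / m.+1%:R * u K.
  move=> FB Fle.
  have S0 : 0 <= S / m.+1%:R by rewrite divr_ge0 ?(ltW m0)//; have := hS 0%N; rewrite big_geq.
  apply: cauchy_limit.
  - by move=> k; rewrite mulr_ge0 ?(ltW (u0 k)).
  - by move=> k; rewrite ler_wpM2l// -subr_ge0 -pu invr_ge0 ltW.
  - apply: (cauchy_schwarz_telescope p0 u0 pu) => K.
    rewrite ler_pdivlMr// mulr_suml; apply: le_trans (hS K); apply: ler_sum => k _.
    rewrite /p /jump -FB mulrAC -(mulrA _ _ m.+1%:R) mulVf ?gt_eqF// mulr1.
    by rewrite ler_wpM2l.
have ReB (z w : R[i]) : complex.Re (z - w) = complex.Re z - complex.Re w by case: z; case: w.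
have ImB (z w : R[i]) : complex.Im (z - w) = complex.Im z - complex.Im w by case: z; case: w.
have Re2 (z : R[i]) : complex.Re z ^+ 2 <= csq z by rewrite lerDl sqr_ge0.
have Im2 (z : R[i]) : complex.Im z ^+ 2 <= csq z by rewrite lerDr sqr_ge0.
have [x hx] := part (@complex.Re R) ReB Re2.
have [y hy] := part (@complex.Im R) ImB Im2.
exists (x +i* y), (S / m.+1%:R + S / m.+1%:R) => K.
rewrite /csq ReB ImB /= -[leRHS](mulfVK (lt0r_neq0 (w0 K))) mulrC ler_pM2r//.
by rewrite mulrDl lerD.
Qed.

                                                                                      
Lemma HlamP m lam f : csq lam = 1 ->
  Hlam m.+1 lam f <-> holo f /\ exists g, hnorm_bounded m g /\ rep lam f g.
Proof.
move=> lam1; have c0 : 0 < (m`! ^ 2 * m.+1)%:R :> R.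
  by rewrite ltr0n muln_gt0 expn_gt0 fact_gt0.
split=> [[hf Df]|[hf [g [[S hS] fg]]]]; split=> //.
(* Any formal g will do first; it is then corrected by a geometric sequence so that its averages
   tend to 0 at the rate which keeps W_K |A_K|^2 bounded. *)
- have [g fg] := rep_exists f lam1.
  have [S hS] := (Dlam_jump m lam1 hf fg).1 Df.
  have [L [S' hS']] := jump_limit hS.
  have [g' [gg' ag]] := rep_shift m g L lam1.
  exists g'; split; last exact: gg'.
  exists ((S + m.+1%:R * S') / (m`! ^ 2 * m.+1)%:R) => K.
  apply: (@le_trans _ _ (\sum_(0 <= k < K.+1) hterm m g' k)).
    by rewrite big_nat_recr//= lerDl hterm_ge0.
  rewrite ler_pdivlMr// mulrC (energy_identity m g' K lam1); apply: lerD.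
    apply: le_trans (hS K); rewrite le_eqVlt; apply/orP; left; apply/eqP.
    by apply: eq_bigr => k _; rewrite /jump !ag opprB addrA subrK.
  by rewrite ag ler_wpM2l.
(* The remainder in the energy identity is nonnegative, so the jumps are bounded by the norm of
   g. *)
- apply/(Dlam_jump m lam1 hf fg); exists ((m`! ^ 2 * m.+1)%:R * S) => K.
  have := energy_identity m g K lam1; have := hS K.+1.
  rewrite -(ler_pM2l c0) => + E; rewrite E; apply: le_trans.
  by rewrite lerDl mulr_ge0// mulr_ge0 ?csq_ge0.
Qed.
End local_douglas.

(** * Cauchy products and the vanishing of the geometric defect *)

Section multipliers.
Variable R : realType.
Implicit Types (f g h phi : nat -> R[i]) (lam : R[i]).

Lemma pmulC f g : pmul f g = pmul g f.
Proof.
apply/funext => k; rewrite /pmul (reindex_inj rev_ord_inj) /=; apply: eq_bigr => i _.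
by rewrite subSS subKn 1?mulrC// -ltnS.
Qed.

Lemma pmul_shiftr phi h : pmul phi (shiftr h) = shiftr (pmul phi h).
Proof.
apply/funext => -[|k]; first by rewrite /pmul big_ord1 /= mulr0.
rewrite /pmul big_ord_recr /= subnn /= mulr0 addr0; apply: eq_bigr => i _.
by rewrite subSn // -ltnS.
Qed.

Lemma pmul_mulsub lam phi h : pmul phi (mulsub lam h) = mulsub lam (pmul phi h).
Proof.
apply/funext => k; rewrite /mulsub -pmul_shiftr /pmul mulr_sumr -sumrB.
by apply: eq_bigr => i _; rewrite mulrBr mulrCA.
Qed.

Lemma pmul_single phi (c : R[i]) : pmul phi (single 0 c) = (fun k => c * phi k).
Proof.
apply/funext => k; rewrite /pmul big_ord_recr /= subnn /single eqxx mulrC big1 ?add0r// => i _.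
by rewrite subn_eq0 leqNgt ltn_ord mulr0.
Qed.

Lemma pmulDr phi f g : pmul phi (fun k => f k + g k) = (fun k => pmul phi f k + pmul phi g k).
Proof.
by apply/funext => k; rewrite /pmul -big_split; apply: eq_bigr => i _; rewrite mulrDr.
Qed.

Lemma rep_mulsub lam f g : rep lam f g ->
  exists c, f = (fun k => single 0 c k + mulsub lam g k).
Proof.
move=> fg; exists (f 0%N + lam * g 0%N); apply/funext => -[|k].
  by rewrite /single eqxx /mulsub /= sub0r addrK.
by rewrite /single /= add0r /mulsub fg.
Qed.

Lemma csqD_le (z w : R[i]) : csq (z + w) <= 2 * (csq z + csq w).
Proof. by rewrite -csq_parallelogram lerDl csq_ge0. Qed.

Lemma hnormD m f g : hnorm_bounded m f -> hnorm_bounded m g ->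
  hnorm_bounded m (fun k => f k + g k).
Proof.
move=> [S hS] [T hT]; exists (2 * (S + T)) => K.
apply: (@le_trans _ _ (2 * (\sum_(0 <= k < K) hterm m f k + \sum_(0 <= k < K) hterm m g k))).
  rewrite -big_split /= mulr_sumr; apply: ler_sum => k _.
  by rewrite /hterm -mulrDr mulrCA ler_wpM2l// csqD_le.
by rewrite ler_wpM2l// lerD.
Qed.

Lemma hnormZ m (c : R[i]) f : hnorm_bounded m f -> hnorm_bounded m (fun k => c * f k).
Proof.
move=> [S hS]; exists (csq c * S) => K.
apply: le_trans (ler_wpM2l (csq_ge0 c) (hS K)); rewrite mulr_sumr; apply: ler_sum => k _.
by rewrite /hterm csqM mulrCA.
Qed.

(** Both factors are square summable, and |xy| <= |x|^2 + |y|^2 bounds each convolution sum. *)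
Lemma pmul_bounded m f g : hnorm_bounded m f -> hnorm_bounded m g ->
  exists B, forall k, cabs (pmul f g k) <= B.
Proof.
move=> /hnorm_square_summable[S hS] /hnorm_square_summable[T hT].
exists (S + T) => k; apply: le_trans (cabs_sum _ _ _) _.
have amgm (x y : R[i]) : 0 <= csq x + csq y - cabs (x * y).
  rewrite cabsM -!sqr_cabs; have := cabs_ge0 x; have := cabs_ge0 y.
  move: (cabs x) (cabs y) => a b b0 a0; nra.
apply: (@le_trans _ _ (\sum_(i < k.+1) csq (f i) + \sum_(i < k.+1) csq (g (k - i)%N))).
  by rewrite -big_split /=; apply: ler_sum => i _; rewrite -subr_ge0.
apply: lerD; first by rewrite -(big_mkord xpredT (fun i => csq (f i))).
rewrite (reindex_inj rev_ord_inj) /=.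
apply: le_trans (hT k.+1); rewrite big_mkord le_eqVlt; apply/orP; left; apply/eqP.
by apply: eq_bigr => i _; rewrite subSS subKn// -ltnS.
Qed.

(** The partial sums of |v_j| for a square-summable v grow more slowly than any positive multiple of
    J. Young's inequality |v| <= c/2 + |v|^2/(2c) absorbs half of the linear term, and a large J
    contradicts c > 0. *)
Lemma linear_growth_zero (c B : R) (v : nat -> R[i]) : 0 <= c ->
  (exists S, forall K, \sum_(0 <= k < K) csq (v k) <= S) ->
  (forall J, J.+1%:R * c <= \sum_(0 <= j < J.+1) cabs (v j) + B) -> c = 0.
Proof.
move=> c0 [S hS] h; apply/eqP; apply: contraT => cn0.
have cp : 0 < c by rewrite lt_neqAle eq_sym cn0.
have le J : J.+1%:R * c / 2 <= S / (2 * c) + B.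
  have young (z : R[i]) : cabs z <= c / 2 + csq z / (2 * c).
    rewrite -sqr_cabs; move: (cabs z) => x; rewrite -subr_ge0.
    have -> : c / 2 + x ^+ 2 / (2 * c) - x = (x - c) ^+ 2 / (2 * c).
      by field; rewrite gt_eqF.
    by rewrite divr_ge0 ?sqr_ge0// mulr_ge0// ltW.
  have : \sum_(0 <= j < J.+1) cabs (v j) <= J.+1%:R * (c / 2) + S / (2 * c).
    apply: (@le_trans _ _ (\sum_(0 <= j < J.+1) (c / 2 + csq (v j) / (2 * c)))).
      by apply: ler_sum => j _; exact: young.
    rewrite big_split /= sumr_const_nat subn0 -mulr_suml -[(c / 2) *+ _]mulr_natl lerD2l.
    by rewrite ler_wpM2r ?hS// invr_ge0 mulr_ge0// ltW.
  by have := h J; lra.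
pose M := (S / (2 * c) + B) / (c / 2).
have := le (Num.trunc `|M|); apply/contraLR => _; rewrite -ltNge.
have -> : S / (2 * c) + B = M * (c / 2) by rewrite /M mulfVK// gt_eqF// divr_gt0.
rewrite -mulrA ltr_pM2r ?divr_gt0//; apply: le_lt_trans (ler_norm M) _.
exact: truncnS_gt.
Qed.

(** As lam^j e_j is constant, (J+1) e_0 is the sum of lam^j e_j over j <= J. Writing phi = c + (z -
    lam) g gives e = (c h - k) + (z - lam) g h: the first part is square summable, and the twisted
    sum of the second telescopes to one coefficient of g h, which is bounded. So e_0 = 0. *)
Lemma geometric_defect_zero m lam phi g h k (e : nat -> R[i]) : csq lam = 1 ->
  hnorm_bounded m g -> hnorm_bounded m h -> hnorm_bounded m k -> rep lam phi g ->
  (forall j, pmul phi h j = k j + e j) -> (forall j, e j = lam * e j.+1) ->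
  forall j, e j = 0.
Proof.
move=> lam1 hg hh hk pg ek es.
have [c pE] := rep_mulsub pg.
have eE j : lam ^+ j * e j = e 0%N.
  by elim: j => [|j <-]; rewrite ?expr0 ?mul1r// (es j) exprSr mulrA.
have [B hB] := pmul_bounded hh hg.
pose v j := c * h j + (-1) * k j.
have ev j : e j = v j + mulsub lam (pmul h g) j.
  have := ek j; rewrite pE pmulC pmulDr pmul_single pmul_mulsub => E.
  by rewrite /v mulN1r [RHS]addrAC E [RHS]addrAC subrr add0r.
have sumE J : J.+1%:R * e 0%N = \sum_(0 <= j < J.+1) lam ^+ j * v j - lam ^+ J.+1 * pmul h g J.
  elim: J => [|J IH].
    rewrite mul1r big_nat1 expr0 mul1r expr1 ev /mulsub /= sub0r //.
  rewrite -natr1 mulrDl IH mul1r [in RHS]big_nat_recr//= -(eE J.+1) ev /mulsub [shiftr _ _]/= (exprSr _ J.+1); ring.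
have e0 : cabs (e 0%N) = 0.
  apply: (@linear_growth_zero _ B v (cabs_ge0 _)).
    by apply: (@hnorm_square_summable _ m); apply: hnormD; exact: hnormZ.
  move=> J; rewrite -(cabs_nat R J.+1) -cabsM sumE; apply: le_trans (cabsD _ _) _.
  rewrite cabsN cabsM cabsX (cabs_unit lam1) expr1n mul1r; apply: lerD => //.
  apply: le_trans (cabs_sum _ _ _) _; apply: ler_sum => j _.
  by rewrite cabsM cabsX (cabs_unit lam1) expr1n mul1r.
move=> j; have l0 := expf_neq0 j (csq1_neq0 lam1); apply: (mulfI l0); rewrite mulr0 eE.
by apply: ComplexField.Normc.eq0_normc; rewrite -cabsE.
Qed.

End multipliers.

Theorem theorem3p5 (R : realType) (n : nat) (lam : R[i]) :
  (1 <= n)%N -> csq lam = 1 ->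
  Mult (Hlam n lam) = Hlam n lam `&` Mult (@Hsig R (n.-1)).
Proof.
case: n => [//|m] _ lam1 /=; apply/seteqP; split => phi.
- move=> [hphi mphi].
  (* The constant 1 is represented with g = 0, so phi = phi 1 lies in the space. *)
  have Hphi : Hlam m.+1 lam phi.
    have -> : phi = pmul phi (single 0 1).
      by rewrite pmul_single; apply/funext => k; rewrite mul1r.
    apply: mphi; apply/(HlamP m _ lam1); split; first exact: holo_single.
    exists (fun=> 0); split; last by move=> k; rewrite /single /= mulr0 subr0.
    by exists 0 => K; rewrite big1// => k _; rewrite /hterm /csq /= expr0n addr0 mulr0.
  split; [exact: Hphi|split; [exact: hphi|]] => h /HsigP hh; apply/HsigP.
  have [_ [g [hg pg]]] := (HlamP m phi lam1).1 Hphi.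
  (* Testing phi on (z - lam) h turns information on H_{lam,m+1} into information on phi h. *)
  have Hz : Hlam m.+1 lam (mulsub lam h).
    apply/(HlamP m _ lam1); split; first exact: holo_mulsub (hnorm_holo hh).
    by exists h; split.
  have := mphi _ Hz; rewrite pmul_mulsub => /(HlamP m _ lam1)[_ [k [hk rk]]].
  suff -> : pmul phi h = k by [].
  have e0 := geometric_defect_zero lam1 hg hh hk pg
    (e := fun j => pmul phi h j - k j).
  apply/funext => j; apply/eqP; rewrite -subr_eq0; apply/eqP; apply: e0 => i.
    by rewrite addrC subrK.
  (* Both phi h and k represent the same function modulo constants, so their difference obeys the
     geometric recursion. *)
  have E : pmul phi h i - lam * pmul phi h i.+1 = k i - lam * k i.+1 by exact: rk.
  transitivity ((pmul phi h i - lam * pmul phi h i.+1) + (lam * pmul phi h i.+1 - k i)).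
    by ring.
  by rewrite E; ring.
- move=> [Hphi [hphi mphi]]; split; [exact: hphi|] => f /(HlamP m _ lam1)[hf [h [hh fh]]].
  have [_ [g [hg pg]]] := (HlamP m phi lam1).1 Hphi.
  apply/(HlamP m _ lam1); split; first exact: holo_pmul.
  have [c fE] := rep_mulsub fh.
  (* With f = c + (z - lam) h, the term c phi contributes c g modulo constants, and (z - lam) h
     contributes phi h. *)
  exists (fun k => c * g k + pmul phi h k); split.
    apply: hnormD; first exact: hnormZ.
    by apply/HsigP; apply: mphi; exact/HsigP.
  move=> k; rewrite fE pmulDr pmul_single pmul_mulsub pg /mulsub /=; ring.
Qed.
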